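(* Let $d \geq 1$ be a natural number and let $q,s$ be co-prime integers such that $1 < qs$. Then there exists a constant $\delta > 0$ depending only on $q,s$ and $d$ such that for every finite $d$-dimensional subset $A$ of $\mathbb{R}^d$ one has \[ |q\cdot A + s\cdot A| \geq (|q| + |s| + 2d-2)|A| - O_{q,s,d}(|A|^{1-\delta}), \] where the implied constant depends only on $q,s$ and $d$.
   Context: For finite $A,B \subseteq \mathbb{R}^d$, $A+B = \{a+b : a\in A, b \in B\}$. For a real number $q$ and $A \subseteq \mathbb{R}^d$, $q\cdot A = \{q a : a \in A\}$ (scalar multiplication of vectors). The dimension of a set $A \subseteq \mathbb{R}^d$ is the dimension of the affine subspace spanned by $A$; thus $A\subseteq\mathbb{R}^d$ is $d$-dimensional if it is not contained in a translate of a hyperplane. The notation $X \geq Y - O_{q,s,d}(Z)$ means that there is a constant $K>0$ depending only on $q,s,d$ with $X \geq Y - K Z$. *)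

(* Defs.v *)
From mathcomp Require Import all_boot all_order all_algebra finmap.

Set Implicit Arguments.
Unset Strict Implicit.
Unset Printing Implicit Defensive.

Import GRing.Theory.
Local Open Scope ring_scope.

Definition sumset (V : zmodType) (A B : {fset V}) : {fset V} :=
  [fset (a + b)%R | a in A, b in B]%fset.

Definition dilate (R : pzRingType) (V : lmodType R) (c : R) (A : {fset V}) :
    {fset V} :=
  [fset (c *: a)%R | a in A]%fset.

Section AffineDimension.
Variables (F : fieldType) (d : nat).
Implicit Type A : {fset 'rV[F]_d}.

Definition affine_direction A : {vspace 'rV[F]_d} :=
  <<[seq a - b | a <- A, b <- A]>>%VS.

(* The dimension of the affine span of A, i.e. of its direction (see
   [affine_spanE]).  The empty set gets dimension 0. *)
Definition affine_dim A : nat := \dim (affine_direction A).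

Lemma affine_spanE A (a0 x : 'rV[F]_d) : a0 \in A ->
  (x - a0 \in affine_direction A) <->
  exists2 c : 'rV[F]_d -> F,
    \sum_(a <- A) c a = 1 & x = \sum_(a <- A) c a *: a.
Proof.
move=> a0A; split; last first.
  move=> [c c1 ->].
  have -> : \sum_(a <- A) c a *: a - a0 = \sum_(a <- A) c a *: (a - a0).
    under [RHS]eq_bigr do rewrite scalerBr.
    by rewrite sumrB -scaler_suml c1 scale1r.
  rewrite big_seq; apply: memv_suml => a aA; apply/memvZ/memv_span.
  by apply/allpairsP; exists (a, a0).
move=> xD.
pose P (v : 'rV[F]_d) := exists2 c : 'rV[F]_d -> F,
  \sum_(a <- A) c a = 0 & v = \sum_(a <- A) c a *: a.
have PD u v : P u -> P v -> P (u + v).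
  move=> [c c0 ->] [e e0 ->]; exists (fun a => c a + e a).
    by rewrite big_split /= c0 e0 addr0.
  by rewrite -big_split; apply: eq_bigr => a _; rewrite scalerDl.
have PZ k v : P v -> P (k *: v).
  move=> [c c0 ->]; exists (fun a => k * c a).
    by rewrite -mulr_sumr c0 mulr0.
  by rewrite scaler_sumr; apply: eq_bigr => a _; rewrite scalerA.
have delta b : b \in A -> \sum_(a <- A) (a == b)%:R = 1 :> F.
  move=> bA; rewrite (bigD1_seq b) ?fset_uniq //= eqxx big1 ?addr0 //.
  by move=> a /negPf ->.
have deltaZ b : b \in A -> \sum_(a <- A) (a == b)%:R *: a = b :> 'rV[F]_d.
  move=> bA; rewrite (bigD1_seq b) ?fset_uniq //= eqxx scale1r big1 ?addr0 //.
  by move=> a /negPf ->; rewrite scale0r.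
suff [c c0 xE] : P (x - a0).
  exists (fun a => c a + (a == a0)%:R).
    by rewrite big_split /= c0 delta // add0r.
  under eq_bigr do rewrite scalerDl.
  by rewrite big_split /= deltaZ // -xE subrK.
rewrite (coord_span (X := in_tuple _) xD).
elim/big_ind: _ => // [|i _].
  by exists (fun=> 0); rewrite big1 // => a _; rewrite scale0r.
apply: PZ; rewrite -tnth_nth.
have /allpairsP[[a b] /= [aA bA ->]] := mem_tnth i (in_tuple _).
exists (fun z => (z == a)%:R - (z == b)%:R).
  by rewrite sumrB !delta // subrr.
under eq_bigr do rewrite scalerBl.
by rewrite sumrB !deltaZ.
Qed.

Lemma affine_dim_fullP A : (0 < d)%N ->
  affine_dim A = d <->
  ~ exists (H : {vspace 'rV[F]_d}) (v : 'rV[F]_d),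
      \dim H = d.-1 /\ {in A, forall a, a - v \in H}.
Proof.
move=> d0; split=> [dimA [H [v [dimH AH]]]|nH].
  have : (affine_direction A <= H)%VS.
    apply/span_subvP => _ /allpairsP[[a b] /= [/AH aH /AH bH ->]].
    have -> : a - b = (a - v) - (b - v) by rewrite opprB addrA subrK.
    exact: memvB.
  by move/dimvS; rewrite -/(affine_dim A) dimA dimH leqNgt ltn_predL d0.
apply/eqP; rewrite eqn_leq; apply/andP; split.
  by rewrite (leq_trans (dimvS (subvf _))) // dimvf /dim /= mul1n.
rewrite leqNgt; apply/negP => ltd; apply: nH.
have extend n (U : {vspace 'rV[F]_d}) : (\dim U <= n <= d)%N ->
    exists2 H : {vspace 'rV[F]_d}, \dim H = n & (U <= H)%VS.
  elim: n => [|n IHn] /andP[Un nd].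
    by exists U; [apply/eqP; rewrite -leqn0|exact: subvv].
  move: Un; rewrite leq_eqVlt => /predU1P[Un|Un]; first by exists U.
  have [|H dimH UH] := IHn; first by rewrite -ltnS Un ltnW.
  have [v _ vH] : exists2 v, v \in fullv & v \notin H.
    apply/subvPn; apply: contraL nd => /dimvS.
    by rewrite dimvf dimH /dim /= mul1n -leqNgt.
  exists (H + <[v]>)%VS; last exact: subv_trans UH (addvSl _ _).
  rewrite dimv_disjoint_sum ?dim_vline ?dimH.
    by case: eqP vH => [->|_ _]; rewrite ?mem0v ?addn1.
  apply/eqP; rewrite -subv0; apply/subvP => w.
  case/memv_capP => wH /vlineP[k wE]; rewrite memv0 wE.
  have [->|k0] := eqVneq k 0; first by rewrite scale0r.
  case/negP: vH; rewrite -[v](scalerK k0) -wE; exact: memvZ.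
have [|H dimH AH] := extend d.-1 (affine_direction A).
  by rewrite leq_pred andbT -ltnS prednK.
have [A0|[v vA]] := fset_0Vmem A; first by exists H, 0; rewrite A0.
exists H, v; split=> // a aA; apply/(subvP AH)/memv_span.
by apply/allpairsP; exists (a, v).
Qed.

End AffineDimension.

(* Main.v *)
Require Import Defs.
From mathcomp Require Import all_boot all_order all_algebra finmap.
From mathcomp Require Import all_classical all_reals all_analysis.
From mathcomp Require Import zify ring lra.

Import Order.TTheory GRing.Theory Num.Theory VectorInternalTheory.
Set Implicit Arguments.
Unset Strict Implicit.
Unset Printing Implicit Defensive.
Local Open Scope fset_scope.
Local Open Scope ring_scope.

(** A finite set of reals, or of real vectors, spans a finite-dimensional rational
vector space, so A may be replaced by a finite set of rational vectors whose
affine span has dimension at least d ([exists_rational_coordinates],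
[affine_dim_le]). Since q and s have the same sign and [-A] has the same sumset
size as [A], they may be taken positive; being coprime with [q s > 1], they are
distinct. Three facts then give the bound.

- On a line ([one_dim], [one_dim_rat]) the sum of dilates has at least
  [(q + s)|A| - O(1)] elements. Starting from the trivial bound, the coefficient
  of [|A|] is raised by a fixed amount at a time: either splitting A into residue
  classes modulo q and s wins a positive proportion of [|A|], or A is so evenly
  spread that the bound [q + s] can be read off directly.

- If the sum of dilates has at most [C |A|] elements, then A lies on
  [O(|A|^(1 - delta))] parallel lines ([few_lines]). Small doubling passes to
  all iterated sums by the inequalities of Petridis and Ruzsa; a pigeonhole over
  scales 1, 2, 4, ... finds a vector w that has a power of [|A|] many multiples
  in a set whose sum with A is only polylogarithmically larger than A.

- Let X be the projection of A along w, and [a_x] the number of points on the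
  line over x. A line contributes [(q + s) a_x - O(1)] to the sum of dilates,
  and two lines over x and y contribute [a_x + a_y - 1] at each of [q x + s y] and
  [q y + s x], provided that these points are not hit twice. In a triangulation
  of X two edges meet in a common vertex at most, so the points that divide the
  edges in the ratio [s : q] are all distinct (for one edge there are two of them
  as q and s differ), and each vertex has degree at least the dimension of X,
  which is at least d - 1 ([delaunay_graph]). Summing over vertices and edges
  gives [(q + s + 2 (d - 1)) |A|] up to a constant times the number of lines
  ([fibration_bound]). *)

(** * Counting in finite sets *)

Lemma leq_card_inj (T U : choiceType) (f : T -> U) (A : {fset T}) (B : {fset U}) :
  {in A &, injective f} -> (forall x, x \in A -> f x \in B) ->
  (#|` A| <= #|` B|)%N.
Proof.
move=> fI fAB; rewrite -(card_in_imfset imfset_key fI).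
by apply: fsubset_leq_card; apply/fsubsetP => _ /imfsetP[x xA ->]; exact: fAB.
Qed.

(** Every lower bound for a sum of dilates below goes through this one: one
exhibits disjoint subsets of it, indexed by pairs of classes, fibres or points. *)
Lemma card_disjoint_family (T U : choiceType) (I : {fset T})
    (G : T -> {fset U}) (Z : {fset U}) :
  (forall p, p \in I -> G p `<=` Z) ->
  (forall p p' z, p \in I -> p' \in I -> z \in G p -> z \in G p' -> p = p') ->
  (\sum_(p <- I) #|` G p| <= #|` Z|)%N.
Proof.
move=> GZ dis.
have H (r : seq T) : uniq r -> {subset r <= I} -> forall Z' : {fset U},
    (forall p, p \in r -> G p `<=` Z') ->
    (\sum_(p <- r) #|` G p| <= #|` Z'|)%N.
  elim: r => [|p r IH] /=; first by rewrite big_nil.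
  move=> /andP[pr ur] rI Z' GZ'; rewrite big_cons -(cardfsID (G p) Z').
  apply: leq_add.
    by apply: fsubset_leq_card; rewrite fsubsetI fsubset_refl GZ' ?mem_head.
  apply: IH => // [x xr|p' p'r]; first by rewrite rI // inE xr orbT.
  apply/fsubsetP => z zG; rewrite inE (fsubsetP (GZ' p' _)) ?inE ?p'r ?orbT //.
  rewrite andbT; apply: contra pr => zp.
  by rewrite (dis p p' z) // rI // inE ?eqxx ?p'r ?orbT.
by apply: H => //; exact: fset_uniq.
Qed.

Lemma sum_card_fibres (T U : choiceType) (f : T -> U) (I : {fset U}) (A : {fset T}) :
  (forall a, a \in A -> f a \in I) ->
  (\sum_(p <- I) #|` [fset a in A | f a == p]| = #|` A|)%N.
Proof.
move=> fI; rewrite card_fset_sum1.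
rewrite (eq_bigr (fun p => \sum_(a <- A) (f a == p : nat))%N); last first.
  by move=> p _; rewrite card_fset_sum1 big_fset /= big_mkcond.
rewrite exchange_big /= big_seq [RHS]big_seq; apply: eq_bigr => a aA.
rewrite (big_fsetD1 (f a)) ?fI //= eqxx big_seq big1 // => p.
by rewrite !inE eq_sym => /andP[/negPf->].
Qed.

Lemma sum_cover_ge (T U : choiceType) (X : {fset U}) (S : {fset T})
    (P : U -> T -> bool) :
  (forall e, e \in S -> exists2 x, x \in X & P x e) ->
  (#|` S| <= \sum_(x <- X) #|` [fset e in S | P x e]|)%N.
Proof.
move=> cov.
rewrite (eq_bigr (fun x => \sum_(e <- S) (P x e : nat))%N); last first.
  by move=> x _; rewrite card_fset_sum1 big_fset /= big_mkcond.
rewrite exchange_big /= card_fset_sum1 big_seq [X in (_ <= X)%N]big_seq.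
apply: leq_sum => e /cov[x xX Px].
by rewrite (big_fsetD1 x) //= Px.
Qed.

Lemma sum_indicator (T : choiceType) (X N : {fset T}) : N `<=` X ->
  (\sum_(y <- X) (y \in N : nat) = #|` N|)%N.
Proof.
move=> NX; have -> : #|` N| = #|` [fset y in X | y \in N]|.
  congr #|` _|; apply/fsetP => y; rewrite !inE andbC.
  by case: (boolP (y \in N)) => // /(fsubsetP NX)->.
rewrite card_fset_sum1 big_fset /= [RHS]big_mkcond.
by apply: eq_bigr => y _; case: (y \in N).
Qed.

Lemma sum_const_fset (T : choiceType) (I : {fset T}) n :
  (\sum_(p <- I) n = #|` I| * n)%N.
Proof. by rewrite card_fset_sum1 big_distrl /=; apply: eq_bigr => p _; rewrite mul1n. Qed.

Lemma sum_fsetM (T U : choiceType) (I : {fset T}) (J : {fset U}) (F : T * U -> nat) :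
  (\sum_(p <- I `*` J) F p = \sum_(i <- I) \sum_(j <- J) F (i, j))%N.
Proof. by rewrite big_imfset2 //= => -[? ?] [? ?] _ _ /= [-> ->]. Qed.

Lemma cardfsM (T U : choiceType) (I : {fset T}) (J : {fset U}) :
  #|` I `*` J| = (#|` I| * #|` J|)%N.
Proof.
rewrite card_fset_sum1 sum_fsetM -sum_const_fset; apply: eq_bigr => i _.
by rewrite -card_fset_sum1.
Qed.

(** Exchanging the second coordinates of two points of a rectangle is a bijection
on pairs of points, so every point is counted equally often. *)
Lemma sum_cross (T U : choiceType) (R : {fset T}) (S : {fset U}) (x : T * U -> nat) :
  (\sum_(p <- R `*` S) \sum_(p' <- R `*` S) x (p.1, p'.2)
    = #|` R| * #|` S| * \sum_(p <- R `*` S) x p)%N.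
Proof.
rewrite [LHS]sum_fsetM /= [in RHS]sum_fsetM big_distrr; apply: eq_bigr => i _.
by rewrite sum_const_fset sum_fsetM /= sum_const_fset mulnCA mulnA.
Qed.

Lemma exists_subset_card (T : choiceType) (A : {fset T}) k : (k <= #|` A|)%N ->
  exists2 B : {fset T}, B `<=` A & #|` B| = k.
Proof.
move=> kA; exists [fset x in take k A].
  by apply/fsubsetP => x; rewrite !inE => /mem_take.
by rewrite card_fseq undup_id ?take_uniq ?fset_uniq // size_takel.
Qed.

Lemma exists_section (V : zmodType) (U : choiceType) (f : V -> U) (A : {fset V}) :
  exists S : {fset V}, [/\ S `<=` A, {in S &, injective f} & #|` S| = #|` f @` A|].
Proof.
have H u : exists a, u \in f @` A -> a \in A /\ f a = u.
  have [/imfsetP[a /= aA ->]|nu] := boolP (u \in f @` A); first by exists a.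
  by exists 0.
have [g Hg] := choice H.
have gI : {in f @` A &, injective g}.
  by move=> u v /Hg[_ {2}<-] /Hg[_ {2}<-] ->.
exists (g @` (f @` A)); split; last by rewrite card_in_imfset.
  by apply/fsubsetP => _ /imfsetP[u /= /Hg[? _] ->].
move=> _ _ /imfsetP[u /= /Hg[_ e] ->] /imfsetP[v /= /Hg[_ e'] ->].
by rewrite e e' => ->.
Qed.

(** * Sums of two dilates *)

Lemma sumsetP (V : zmodType) (A B : {fset V}) z :
  reflect (exists2 a, a \in A & exists2 b, b \in B & z = a + b)
          (z \in sumset A B).
Proof.
apply: (iffP idP).
  by move=> /imfset2P[a aA [b bB ->]]; exists a => //; exists b.
by move=> [a aA [b bB ->]]; apply/imfset2P; exists a => //; exists b.
Qed.

Lemma mem_sumset (V : zmodType) (A B : {fset V}) a b :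
  a \in A -> b \in B -> a + b \in sumset A B.
Proof. by move=> aA bB; apply/sumsetP; exists a => //; exists b. Qed.

(** The dilates are taken by natural multiples, so that the same notion serves for
sets of integers, of rational vectors and of real vectors. *)
Definition dsum (V : zmodType) (q s : nat) (A B : {fset V}) : {fset V} :=
  [fset a *+ q + b *+ s | a in A, b in B].

Lemma dsumP (V : zmodType) q s (A B : {fset V}) z :
  reflect (exists2 a, a \in A & exists2 b, b \in B & z = a *+ q + b *+ s)
          (z \in dsum q s A B).
Proof.
apply: (iffP idP).
  by move=> /imfset2P[a aA [b bB ->]]; exists a => //; exists b.
by move=> [a aA [b bB ->]]; apply/imfset2P; exists a => //; exists b.
Qed.

Lemma mem_dsum (V : zmodType) q s (A B : {fset V}) a b :
  a \in A -> b \in B -> a *+ q + b *+ s \in dsum q s A B.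
Proof. by move=> aA bB; apply/dsumP; exists a => //; exists b. Qed.

Lemma dsumC (V : zmodType) q s (A B : {fset V}) : dsum q s A B = dsum s q B A.
Proof.
apply/fsetP => z; apply/dsumP/dsumP => -[a aA [b bB ->]];
  by exists b => //; exists a => //; rewrite addrC.
Qed.

Lemma dsumS (V : zmodType) q s (A A' B B' : {fset V}) :
  A `<=` A' -> B `<=` B' -> dsum q s A B `<=` dsum q s A' B'.
Proof.
move=> /fsubsetP AA /fsubsetP BB; apply/fsubsetP => z /dsumP[a /AA aA [b /BB bB ->]].
exact: mem_dsum.
Qed.

Definition torsion_free (V : zmodType) :=
  forall (x : V) n, (0 < n)%N -> x *+ n = 0 -> x = 0.

Section TorsionFree.
Variable V : zmodType.
Hypothesis tf : torsion_free V.

Lemma mulrn_injective n : (0 < n)%N -> injective (fun x : V => x *+ n).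
Proof.
move=> n0 x y /eqP; rewrite -subr_eq0 -mulrnBl => /eqP /(tf n0) /eqP.
by rewrite subr_eq0 => /eqP.
Qed.

Lemma card_dsum_l q s (A B : {fset V}) :
  (0 < q)%N -> B != fset0 -> (#|` A| <= #|` dsum q s A B|)%N.
Proof.
move=> q0 /fset0Pn[b bB].
apply: (@leq_card_inj _ _ (fun a => a *+ q + b *+ s)).
  by move=> x y _ _ /addIr /(mulrn_injective q0).
by move=> x xA; exact: mem_dsum.
Qed.

End TorsionFree.

Lemma num_torsion_free (R : numDomainType) : torsion_free R.
Proof. by move=> x n n0 /eqP; rewrite mulrn_eq0 (gtn_eqF n0) /= => /eqP. Qed.

Lemma fset_min (R : realDomainType) (A : {fset R}) : A != fset0 ->
  exists2 m, m \in A & forall a, a \in A -> m <= a.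
Proof.
move=> /fset0Pn[a0 a0A].
case: (@Order.TotalTheory.arg_minP _ _ A [` a0A] predT val isT) => m _ H.
exists (val m); first exact: valP.
by move=> a aA; exact: (H [` aA]).
Qed.

Lemma fset_max (R : realDomainType) (A : {fset R}) : A != fset0 ->
  exists2 m, m \in A & forall a, a \in A -> a <= m.
Proof.
move=> /fset0Pn[a0 a0A].
case: (@Order.TotalTheory.arg_maxP _ _ A [` a0A] predT val isT) => m _ H.
exists (val m); first exact: valP.
by move=> a aA; exact: (H [` aA]).
Qed.

(** The sums with the largest element of A and those with the smallest element of
B form two chains that share a single point. *)
Lemma card_dsum_ge (R : realDomainType) q s (A B : {fset R}) :
  (0 < q)%N -> (0 < s)%N -> A != fset0 -> B != fset0 ->
  (#|` A| + #|` B| <= #|` dsum q s A B| + 1)%N.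
Proof.
move=> q0 s0 A0 B0.
have [M MA Mmax] := fset_max A0; have [m mB mmin] := fset_min B0.
pose P := [fset a *+ q + m *+ s | a in A]; pose Q := [fset M *+ q + b *+ s | b in B].
have cP : #|` P| = #|` A|.
  by rewrite card_imfset // => x y /addIr /(mulrn_injective (@num_torsion_free R) q0).
have cQ : #|` Q| = #|` B|.
  by rewrite card_imfset // => x y /addrI /(mulrn_injective (@num_torsion_free R) s0).
rewrite -cP -cQ -cardfsUI leq_add //.
  apply: fsubset_leq_card; rewrite fsubUset; apply/andP; split;
    apply/fsubsetP => _ /imfsetP[x xA ->]; exact: mem_dsum.
rewrite -(cardfs1 (M *+ q + m *+ s)); apply: fsubset_leq_card.
apply/fsubsetP => z; rewrite !inE => /andP[/imfsetP[a /= aA ->] /imfsetP[b /= bB e]].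
have h1 : a *+ q <= M *+ q by rewrite lerMn2r // Mmax ?orbT.
have h2 : m *+ s <= b *+ s by rewrite lerMn2r // mmin ?orbT.
apply/eqP; lra.
Qed.

Lemma dsum_imfset (U V : zmodType) (f : U -> V) q s (A B : {fset U}) :
  (forall a b, f (a *+ q + b *+ s) = f a *+ q + f b *+ s) ->
  dsum q s (f @` A) (f @` B) = f @` (dsum q s A B).
Proof.
move=> fE; apply/fsetP => z; apply/dsumP/imfsetP.
  move=> [_ /imfsetP[a /= aA ->] [_ /imfsetP[b /= bB ->] ->]].
  by exists (a *+ q + b *+ s); rewrite ?fE //; exact: mem_dsum.
move=> [_ /= /dsumP[a aA [b bB ->]] ->].
exists (f a); first by apply/imfsetP; exists a.
by exists (f b); [apply/imfsetP; exists b|rewrite fE].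
Qed.

(** * Residue classes of a set of integers *)

Lemma mulrn_int (x : int) n : x *+ n = x * n%:Z.
Proof. by rewrite pmulrn mulrzz. Qed.

Lemma modz_eqP (a b : int) (m : nat) :
  (a %% m%:Z)%Z = (b %% m%:Z)%Z <-> exists k, a = b + k * m%:Z.
Proof.
split=> [/eqP|[k ->]]; last by rewrite addrC modzMDl.
by rewrite eqz_mod_dvd => /dvdzP[k h]; exists k; rewrite -h; ring.
Qed.

Lemma coprime_dvd_mul (m n : nat) (x y : int) :
  (0 < m)%N -> coprime m n -> x * n%:Z = y * m%:Z -> exists k, x = k * m%:Z.
Proof.
move=> m0 co h; apply/dvdzP.
have : (m%:Z %| x * n%:Z)%Z by apply/dvdzP; exists y.
by rewrite mulrC Gauss_dvdzr.
Qed.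

Definition residues (m : nat) (A : {fset int}) : {fset int} :=
  [fset (a %% m%:Z)%Z | a in A].

Definition residue_class (m : nat) (i : int) (A : {fset int}) : {fset int} :=
  [fset a in A | (a %% m%:Z)%Z == i].

Lemma in_residue_class m i A a : (a \in residue_class m i A) = (a \in A) && ((a %% m%:Z)%Z == i).
Proof. by rewrite !inE. Qed.

Lemma residue_class_sub m i A : residue_class m i A `<=` A.
Proof. by apply/fsubsetP => a; rewrite in_residue_class => /andP[]. Qed.

Lemma card_residues m A : (0 < m)%N -> (#|` residues m A| <= m)%N.
Proof.
move=> m0; have mz : m%:Z != 0 by lia.
have cm : #|` [fset x in iota 0 m]| = m.
  by rewrite card_fseq undup_id ?iota_uniq // size_iota.
rewrite -[X in (_ <= X)%N]cm; apply: (@leq_card_inj _ _ absz).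
  move=> _ _ /imfsetP[a /= _ ->] /imfsetP[b /= _ ->] h.
  have := modz_ge0 a mz; have := modz_ge0 b mz; lia.
move=> _ /imfsetP[a /= _ ->]; rewrite !inE mem_iota /=.
by have := modz_ge0 a mz; have := @ltz_pmod a m%:Z; lia.
Qed.

(** Membership of 0 and the second clause say that the differences of elements of A
generate the integers; in the form of an induction principle for subgroups this
is directly applicable. *)
Definition normalised (A : {fset int}) :=
  0 \in A /\ forall S : int -> Prop, S 0 ->
    (forall x y, S x -> S y -> S (x + y)) -> (forall x, S x -> S (- x)) ->
    (forall a, a \in A -> S a) -> forall n, S n.

Section Residues.
Variables q s : nat.
Hypotheses (q0 : (0 < q)%N) (s0 : (0 < s)%N) (co : coprime q s).

Let tfz := @num_torsion_free int.

Lemma sum_residue_l (a b a' b' : int) :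
  a *+ q + b *+ s = a' *+ q + b' *+ s -> (a %% s%:Z)%Z = (a' %% s%:Z)%Z.
Proof.
move=> h; apply/modz_eqP.
have [k hk] : exists k, a - a' = k * s%:Z.
  apply: (@coprime_dvd_mul s q _ (b' - b)) => //; first by rewrite coprime_sym.
  by move: h; rewrite !mulrn_int; nia.
by exists k; rewrite -hk; ring.
Qed.

(** A sum [q a + s b] determines a modulo s. The sums with a fixed [a0] are [|A|]
many, and none of them occurs once the class of [a0] modulo s is removed. *)
Lemma card_dsum_remove_class (A : {fset int}) a0 : a0 \in A ->
  (#|` dsum q s (A `\` residue_class s (a0 %% s%:Z)%Z A) (A `\` residue_class s (a0 %% s%:Z)%Z A)|
    + #|` A| <= #|` dsum q s A A|)%N.
Proof.
move=> a0A; set A' := A `\` _.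
pose Y := [fset a0 *+ q + b *+ s | b in A].
have -> : #|` A| = #|` Y|.
  by rewrite card_imfset // => x y /addrI /(mulrn_injective tfz s0).
rewrite -cardfsUI [X in (_ + X)%N](_ : _ = 0%N) ?addn0.
  apply: fsubset_leq_card; rewrite fsubUset dsumS ?fsubsetDl //=.
  by apply/fsubsetP => _ /imfsetP[b /= bA ->]; exact: mem_dsum.
apply/eqP; rewrite cardfs_eq0; apply/eqP/fsetP => z; rewrite !inE.
apply/negP => /andP[/dsumP[a aA [b bA ->]] /imfsetP[b' /= b'A h]].
by move: aA; rewrite !inE (sum_residue_l h) eqxx; case: (a \in A).
Qed.

End Residues.

Section ResiduePairs.
Variables q s : nat.
Hypotheses (q0 : (0 < q)%N) (s0 : (0 < s)%N) (co : coprime q s).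

Lemma sum_residue_r (a b a' b' : int) :
  a *+ q + b *+ s = a' *+ q + b' *+ s -> (b %% q%:Z)%Z = (b' %% q%:Z)%Z.
Proof.
move=> h; have co' : coprime s q by rewrite coprime_sym.
have e : b *+ s + a *+ q = b' *+ s + a' *+ q by rewrite addrC h addrC.
exact: (sum_residue_l s0 q0 co' e).
Qed.

Definition residue_pairs (A : {fset int}) : {fset int * int} :=
  residues s A `*` residues q A.

Lemma residue_pairsP A p :
  reflect (exists2 a, a \in A & exists2 b, b \in A &
             p = ((a %% s%:Z)%Z, (b %% q%:Z)%Z)) (p \in residue_pairs A).
Proof.
rewrite !inE; apply: (iffP andP).
  case: p => i l /= [/imfsetP[a /= aA ->] /imfsetP[b /= bA ->]].
  by exists a => //; exists b.
move=> [a aA [b bA ->]] /=; split; apply/imfsetP; [by exists a|by exists b].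
Qed.

(** By the Chinese remainder theorem these are the residue classes modulo [q s];
keeping the two residues apart matches the way in which they enter a sum. *)
Definition bi_class (A : {fset int}) (p : int * int) := residue_class q p.2 (residue_class s p.1 A).

Lemma in_bi_class A p a : (a \in bi_class A p) =
  [&& a \in A, (a %% s%:Z)%Z == p.1 & (a %% q%:Z)%Z == p.2].
Proof. by rewrite !in_residue_class andbA. Qed.

(** The part of the sum of dilates that has prescribed residues: a sum [q a + s b]
shows a modulo s and b modulo q. *)
Definition class_dsum (A : {fset int}) (p : int * int) :=
  dsum q s (residue_class s p.1 A) (residue_class q p.2 A).

Lemma sum_class_dsum A :
  (\sum_(p <- residue_pairs A) #|` class_dsum A p| <= #|` dsum q s A A|)%N.
Proof.
apply: card_disjoint_family => [p _|]; first by apply: dsumS; exact: residue_class_sub.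
move=> [i l] [i' l'] z _ _ /dsumP[a + [b + ->]] /dsumP[a' + [b' + h]].
rewrite !in_residue_class /= => /andP[_ /eqP <-] /andP[_ /eqP <-] /andP[_ /eqP <-] /andP[_ /eqP <-].
by congr pair; [exact: (sum_residue_l q0 s0 co h)|exact: (sum_residue_r h)].
Qed.

Lemma sum_bi_class A : (\sum_(p <- residue_pairs A) #|` bi_class A p| = #|` A|)%N.
Proof.
rewrite -(@sum_card_fibres _ _ (fun a : int => ((a %% s%:Z)%Z, (a %% q%:Z)%Z)) (residue_pairs A)).
  by apply: eq_bigr => p _; congr #|` _|; apply/fsetP => a; rewrite in_bi_class !inE.
by move=> a aA; apply/residue_pairsP; exists a => //; exists a.
Qed.

Lemma card_residue_pairs A : (#|` residue_pairs A| <= q * s)%N.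
Proof.
rewrite cardfsM mulnC.
by apply: leq_mul; exact: card_residues.
Qed.

(** The inductive step of the one-dimensional bound: applying the bound with
coefficient k to each class recovers k for A, and a single class pair that
exceeds its share by [|A|] raises the coefficient to k + 1. *)
Lemma class_dsum_gain k E B A p0 :
  (forall A' : {fset int}, k * #|` A'| <= E * #|` dsum q s A' A'| + B)%N ->
  p0 \in residue_pairs A ->
  (k * #|` bi_class A p0| + #|` A| <= E * #|` class_dsum A p0| + B)%N ->
  ((k + 1) * #|` A| <= E * #|` dsum q s A A| + q * s * B)%N.
Proof.
move=> IH p0I gain.
have step p : p \in residue_pairs A ->
    (k * #|` bi_class A p| + (if p == p0 then #|` A| else 0)
      <= E * #|` class_dsum A p| + B)%N.
  move=> _; case: eqP => [->|_] //.
  rewrite addn0 (leq_trans (IH _)) // leq_add2r leq_mul2l.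
  rewrite fsubset_leq_card ?orbT //; apply: dsumS; apply/fsubsetP => a;
  by rewrite in_bi_class in_residue_class => /and3P[h1 h2 h3]; rewrite ?h1 ?h2 ?h3.
have : (\sum_(p <- residue_pairs A) (k * #|` bi_class A p| + (if p == p0 then #|` A| else 0))
   <= \sum_(p <- residue_pairs A) (E * #|` class_dsum A p| + B))%N.
  by rewrite big_seq [X in (_ <= X)%N]big_seq; apply: leq_sum.
rewrite !big_split /= -!big_distrr /= sum_bi_class sum_const_fset.
rewrite (big_fsetD1 p0) //= eqxx big_seq [X in (_ + (_ + X))%N]big1; last first.
  by move=> p; rewrite !inE => /andP[/negPf->].
have := leq_mul (leqnn E) (sum_class_dsum A).
have := leq_mul (card_residue_pairs A) (leqnn B).
move=> h1 h2; rewrite addn0 mulnDl mul1n => h3.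
exact: leq_trans h3 (leq_add h2 h1).
Qed.
End ResiduePairs.

(** * Residues that are missing modulo a square *)

(** For a set P inside one class modulo m: P meets each of the m classes modulo
[m ^ 2] that lie over it. *)
Definition meets_all_lifts (m : nat) (P : {fset int}) :=
  forall a0 t, a0 \in P -> exists2 a, a \in P &
    exists w, a0 + t * m%:Z = a + w * (m * m)%:Z.

Section Lifts.
Variables q s : nat.
Hypotheses (q0 : (0 < q)%N) (s0 : (0 < s)%N) (co : coprime q s).
Let tfz := @num_torsion_free int.

(** The shifts n for which [q P + s n] stays within [q P] modulo [s ^ 2] form a
subgroup of the integers. If no sum [q a0 + s b] were new modulo [s ^ 2], this
subgroup would contain all differences of A, hence every integer, and P would
meet all its lifts. *)
Lemma missing_lift (A P : {fset int}) : normalised A -> P `<=` A ->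
  (forall a b, a \in P -> b \in P -> (a %% s%:Z)%Z = (b %% s%:Z)%Z) ->
  ~ meets_all_lifts s P ->
  exists2 a0, a0 \in P & exists2 b, b \in A & forall a1 b1 b' w,
    a1 \in P -> b1 \in P -> (b' %% s%:Z)%Z = (b %% s%:Z)%Z ->
    a0 *+ q + b' *+ s <> a1 *+ q + b1 *+ s + w * (s * s)%:Z.
Proof.
move=> [A0 nA] PA Pi nl; apply: contrapT => H; apply: nl => p0 t p0P.
(* S is closed under negation because it contains the multiples of s
   and [- x = (s - 1) x - s x]. *)
pose S (n : int) := forall a0, a0 \in P -> exists2 a1, a1 \in P &
  exists w, a0 *+ q + n *+ s = a1 *+ q + w * (s * s)%:Z.
have S0 : S 0 by move=> a aP; exists a => //; exists 0; ring.
have SD x y : S x -> S y -> S (x + y).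
  move=> Sx Sy a /Sx[a1 /Sy[a2 a2P [w2 e2]] [w1 e1]]; exists a2 => //.
  by exists (w1 + w2); rewrite mulrnDl addrA e1 addrAC e2; ring.
have SM x n : S x -> S (x *+ n).
  by move=> Sx; elim: n => [|n IH]; rewrite ?mulr0n ?mulrS //; exact: SD.
have SN x : S x -> S (- x).
  move=> Sx a aP; have [a1 a1P [w e]] := SM x s.-1 Sx a aP.
  exists a1 => //; exists (w - x).
  have xs : x *+ s.-1 *+ s = x * (s * s)%:Z - x *+ s.
    by rewrite !mulrn_int; case: (s) s0 => // n _ /=; rewrite !PoszM -addn1 PoszD; ring.
  move: e; rewrite xs mulNrn mulrBl.
  move: (x *+ s) (a *+ q) (a1 *+ q) (x * _) (w * _) => *; lra.
have SA b : b \in A -> S (b - p0).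
  move=> bA a0 a0P; apply: contrapT => H1; apply: H; exists a0 => //; exists b => //.
  move=> a1 b1 b' w a1P b1P /modz_eqP[k1 ->] e; apply: H1; exists a1 => //.
  have /modz_eqP[k2 e2] := Pi _ _ b1P p0P.
  exists (w + k2 - k1); move: e; rewrite e2 !mulrn_int !PoszM.
  by move: (s%:Z) (q%:Z) => s' q' e; lra.
have SAll n : S n.
  apply: (nA S) => // a aA; rewrite -(subrK p0 a); apply: SD; first exact: SA.
  by rewrite -[p0]opprK -[- p0]add0r; apply: SN; exact: SA.
have [a1 a1P [w e]] := SAll (t * q%:Z) p0 p0P.
exists a1 => //.
have [k hk] : exists k, p0 + t * s%:Z - a1 = k * (s * s)%:Z.
  apply: (@coprime_dvd_mul (s * s) q _ w); first by rewrite muln_gt0 s0.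
    by rewrite coprime_sym coprimeMr co.
  by move: e; rewrite !mulrn_int !PoszM; move: (s%:Z) (q%:Z) => s' q' e; lra.
by exists k; rewrite -hk [RHS]addrC subrK.
Qed.

(** The new sum found by [missing_lift] depends on the second summand modulo s
only, so it comes with a translate of a whole class. *)
Lemma missing_lift_gain (A : {fset int}) p : normalised A ->
  (forall p', p' \in residue_pairs q s A -> bi_class q s A p' != fset0) ->
  p \in residue_pairs q s A -> ~ meets_all_lifts s (bi_class q s A p) ->
  exists2 p', p' \in residue_pairs q s A &
    (#|` dsum q s (bi_class q s A p) (bi_class q s A p)| + #|` bi_class q s A p'|
      <= #|` class_dsum q s A p|)%N.
Proof.
move=> nA ne pI nl.
have PA : bi_class q s A p `<=` A.
  by apply/fsubsetP => a; rewrite in_bi_class => /andP[].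
have [|a0 a0P [b bA H]] := missing_lift nA PA _ nl.
  by move=> a b; rewrite !in_bi_class => /and3P[_ /eqP-> _] /and3P[_ /eqP-> _].
pose p' := ((b %% s%:Z)%Z, p.2).
have p'I : p' \in residue_pairs q s A.
  case/residue_pairsP: pI => a aA [c cA pE]; apply/residue_pairsP; exists b => //.
  by exists c => //; rewrite /p' pE.
exists p' => //.
pose Y := [fset a0 *+ q + b' *+ s | b' in bi_class q s A p'].
have cY : #|` Y| = #|` bi_class q s A p'|.
  by rewrite card_imfset // => x y /addrI /(mulrn_injective tfz s0).
rewrite -cY -cardfsUI [X in (_ + X)%N](_ : _ = 0%N) ?addn0.
  apply: fsubset_leq_card; rewrite fsubUset dsumS /=.
  - apply/fsubsetP => _ /imfsetP[b' /= b'P ->]; apply: mem_dsum.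
      by move: a0P; rewrite in_bi_class in_residue_class => /and3P[-> ->].
    by move: b'P; rewrite in_bi_class in_residue_class => /and3P[-> _ ->].
  - by apply/fsubsetP => a; rewrite in_bi_class in_residue_class => /and3P[-> ->].
  - by apply/fsubsetP => a; rewrite in_bi_class in_residue_class => /and3P[-> _ ->].
apply/eqP; rewrite cardfs_eq0; apply/eqP/fsetP => z; rewrite !inE.
apply/negP => /andP[/dsumP[a1 a1P [b1 b1P ->]] /imfsetP[b' /= b'P h]].
apply: (H a1 b1 b' 0) => //; last by rewrite mul0r addr0.
by move: b'P; rewrite in_bi_class => /and3P[_ /eqP-> _].
Qed.

End Lifts.

(** * Sets that meet every lift of their residues *)

Lemma card_residues_lifts m P : (0 < m)%N -> P != fset0 -> meets_all_lifts m P ->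
  (m <= #|` residues (m * m) P|)%N.
Proof.
move=> m0 /fset0Pn[p0 p0P] lP.
have cm : #|` [fset x in iota 0 m]| = m.
  by rewrite card_fseq undup_id ?iota_uniq // size_iota.
rewrite -[X in (X <= _)%N]cm.
apply: (@leq_card_inj _ _ (fun t : nat => ((p0 + t%:Z * m%:Z) %% (m * m)%:Z)%Z)).
  move=> t t'; rewrite !inE !mem_iota /= => tm t'm /modz_eqP[k].
  rewrite PoszM mulrA -addrA -mulrDl => /addrI /(mulIf (_ : m%:Z != 0)) e.
  have {}e : t%:Z = t'%:Z + k * m%:Z by apply: e; lia.
  have k0 : k = 0 by nia.
  by move: e; rewrite k0; lia.
move=> t _; have [a aP [w e]] := lP p0 t%:Z p0P.
by rewrite e addrC modzMDl; apply/imfsetP; exists a.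
Qed.

Lemma card_residues_le m A : (#|` residues m A| <= #|` A|)%N.
Proof. exact: leq_imfset_card. Qed.

Section SquareResidues.
Variables q s : nat.
Hypotheses (q0 : (0 < q)%N) (s0 : (0 < s)%N) (co : coprime q s).

(** Once the residue of b modulo s is fixed, a sum [q a + s b] determines a even
modulo [s ^ 2]. *)
Lemma sum_residue_sq_l (a b a' b' : int) :
  (b %% s%:Z)%Z = (b' %% s%:Z)%Z -> a *+ q + b *+ s = a' *+ q + b' *+ s ->
  (a %% (s * s)%:Z)%Z = (a' %% (s * s)%:Z)%Z.
Proof.
move=> /modz_eqP[k ->] h; apply/modz_eqP.
have [w hw] : exists w, a - a' = w * (s * s)%:Z.
  apply: (@coprime_dvd_mul (s * s) q _ (- k)); first by rewrite muln_gt0 s0.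
    by rewrite coprime_sym coprimeMr co.
  move: h; rewrite PoszM !mulrn_int.
  by move: (s%:Z) (q%:Z) => s' q' h; lra.
by exists w; rewrite -hw [RHS]addrC subrK.
Qed.

End SquareResidues.

Section FullLifts.
Variables q s : nat.
Hypotheses (q0 : (0 < q)%N) (s0 : (0 < s)%N) (co : coprime q s).

(** Splitting P modulo [s ^ 2] and Q modulo [q ^ 2] makes the partial sums disjoint,
and P and Q fall into at least s and q parts. Each pair of parts satisfies the
two-set bound, which counts P at least q times and Q at least s times. *)
Lemma card_dsum_lifts (P Q : {fset int}) : P != fset0 -> Q != fset0 ->
  (forall a b, a \in P -> b \in P -> (a %% q%:Z)%Z = (b %% q%:Z)%Z) ->
  (forall a b, a \in Q -> b \in Q -> (a %% s%:Z)%Z = (b %% s%:Z)%Z) ->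
  meets_all_lifts s P -> meets_all_lifts q Q ->
  (q * #|` P| + s * #|` Q| <= #|` dsum q s P Q| + q * s)%N.
Proof.
move=> P0 Q0 Pq Qs lP lQ.
pose RP := residues (s * s) P; pose RQ := residues (q * q) Q.
(* P and Q have at least s and q parts; the counting bound is increasing
   in the numbers of parts as long as no part is empty. *)
have hs : (s <= #|` RP|)%N by exact: card_residues_lifts.
have hq : (q <= #|` RQ|)%N by exact: card_residues_lifts.
have hP : (#|` RP| <= #|` P|)%N by exact: card_residues_le.
have hQ : (#|` RQ| <= #|` Q|)%N by exact: card_residues_le.
pose G (p : int * int) := dsum q s (residue_class (s * s) p.1 P) (residue_class (q * q) p.2 Q).
have sG : (\sum_(p <- RP `*` RQ) #|` G p| <= #|` dsum q s P Q|)%N.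
  apply: card_disjoint_family => [p _|]; first by apply: dsumS; exact: residue_class_sub.
  move=> [i l] [i' l'] z _ _ /dsumP[a + [b + ->]] /dsumP[a' + [b' + h]].
  rewrite !in_residue_class /= => /andP[aP /eqP <-] /andP[bQ /eqP <-] /andP[a'P /eqP <-] /andP[b'Q /eqP <-].
  congr pair; first by apply: (sum_residue_sq_l s0 co _ h); exact: Qs.
  have co' : coprime s q by rewrite coprime_sym.
  have e : b *+ s + a *+ q = b' *+ s + a' *+ q by rewrite addrC h addrC.
  by apply: (sum_residue_sq_l q0 co' _ e); exact: Pq.
have : (\sum_(p <- RP `*` RQ) (#|` residue_class (s * s) p.1 P| + #|` residue_class (q * q) p.2 Q|)
   <= \sum_(p <- RP `*` RQ) (#|` G p| + 1))%N.
  rewrite big_seq [X in (_ <= X)%N]big_seq; apply: leq_sum => -[i l].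
  rewrite !inE /= => /andP[/imfsetP[a /= aP ->] /imfsetP[b /= bQ ->]].
  rewrite /G /=; apply: (@card_dsum_ge int q s) => //; apply/fset0Pn;
    [exists a|exists b]; rewrite in_residue_class.
    by rewrite aP eqxx.
  by rewrite bQ eqxx.
have e1 : (\sum_(i <- RP) #|` residue_class (s * s) i P| = #|` P|)%N.
  by apply: sum_card_fibres => a aP; apply/imfsetP; exists a.
have e2 : (\sum_(i <- RQ) #|` residue_class (q * q) i Q| = #|` Q|)%N.
  by apply: sum_card_fibres => a aQ; apply/imfsetP; exists a.
have e3 : (\sum_(p <- RP `*` RQ) #|` residue_class (s * s) p.1 P| = #|` RQ| * #|` P|)%N.
  rewrite sum_fsetM /= -e1 big_distrr; apply: eq_bigr => i _.
  by rewrite sum_const_fset.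
have e4 : (\sum_(p <- RP `*` RQ) #|` residue_class (q * q) p.2 Q| = #|` RP| * #|` Q|)%N.
  by rewrite sum_fsetM /= sum_const_fset e2.
rewrite !big_split /= e3 e4 sum_const_fset cardfsM muln1 => h.
have {sG}h := leq_trans h (leq_add sG (leqnn _)); move: h.
move: (#|` P|) (#|` Q|) (#|` RP|) (#|` RQ|) hs hq hP hQ (#|` dsum q s P Q|) => x y a b hs hq hP hQ F h; clear -hs hq hP hQ h.
nia.
Qed.

(** For a class pair [(i, l)] one may use the points of A in class i modulo s with
any residue modulo q, and those in class l modulo q with any residue modulo s,
since all of these meet all lifts. Averaging over the two free residues turns the
bounds of [card_dsum_lifts] into the full coefficient [q + s]. *)
Lemma all_lifts_bound (A : {fset int}) :
  (forall p, p \in residue_pairs q s A -> [/\ bi_class q s A p != fset0,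
     meets_all_lifts s (bi_class q s A p) & meets_all_lifts q (bi_class q s A p)]) ->
  A != fset0 ->
  ((q + s) * #|` A| <= #|` dsum q s A A| + (q * s) * (q * s))%N.
Proof.
move=> H A0; pose I := residue_pairs q s A.
pose x p := #|` bi_class q s A p|.
have key p p' : p \in I -> p' \in I ->
    (q * x (p.1, p'.2) + s * x (p'.1, p.2) <= #|` class_dsum q s A p| + q * s)%N.
  case/residue_pairsP => a aA [b bA ->] /residue_pairsP[a' a'A [b' b'A ->]] /=.
  have [|P0 lP _] := H ((a %% s%:Z)%Z, (b' %% q%:Z)%Z).
    by apply/residue_pairsP; exists a => //; exists b'.
  have [|Q0 _ lQ] := H ((a' %% s%:Z)%Z, (b %% q%:Z)%Z).
    by apply/residue_pairsP; exists a' => //; exists b.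
  apply: leq_trans (card_dsum_lifts P0 Q0 _ _ lP lQ) _.
  - by move=> u v; rewrite !in_bi_class => /and3P[_ _ /eqP->] /and3P[_ _ /eqP->].
  - by move=> u v; rewrite !in_bi_class => /and3P[_ /eqP-> _] /and3P[_ /eqP-> _].
  rewrite leq_add2r; apply: fsubset_leq_card; apply: dsumS;
    by apply/fsubsetP => u; rewrite in_bi_class in_residue_class /= => /and3P[h1 h2 h3]; rewrite ?h1 ?h2 ?h3.
have : (\sum_(p <- I) \sum_(p' <- I) (q * x (p.1, p'.2) + s * x (p'.1, p.2))
  <= \sum_(p <- I) \sum_(p' <- I) (#|` class_dsum q s A p| + q * s))%N.
  rewrite big_seq [X in (_ <= X)%N]big_seq; apply: leq_sum => p pI.
  rewrite big_seq [X in (_ <= X)%N]big_seq; apply: leq_sum => p' p'I.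
  exact: key.
pose a := #|` residues s A|; pose b := #|` residues q A|.
have cI : #|` I| = (a * b)%N by exact: cardfsM.
have e1 : (\sum_(p <- I) \sum_(p' <- I) q * x (p.1, p'.2) = a * b * (q * #|` A|))%N.
  rewrite -(sum_bi_class q s A) big_distrr /=.
  exact: (sum_cross _ _ (fun p => q * x p)%N).
have e2 : (\sum_(p <- I) \sum_(p' <- I) s * x (p'.1, p.2) = a * b * (s * #|` A|))%N.
  rewrite exchange_big /= -(sum_bi_class q s A) big_distrr /=.
  exact: (sum_cross _ _ (fun p => s * x p)%N).
under eq_bigr do rewrite big_split /=.
rewrite big_split /= e1 e2.
under [X in (_ <= X)%N]eq_bigr do rewrite sum_const_fset mulnDr.
rewrite big_split /= -big_distrr /= sum_const_fset cI.
have := sum_class_dsum q0 s0 co A; rewrite -/I.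
have a0 : (0 < a)%N.
  rewrite cardfs_gt0; have /fset0Pn[u uA] := A0; apply/fset0Pn.
  by exists (u %% s%:Z)%Z; apply/imfsetP; exists u.
have b0 : (0 < b)%N.
  rewrite cardfs_gt0; have /fset0Pn[u uA] := A0; apply/fset0Pn.
  by exists (u %% q%:Z)%Z; apply/imfsetP; exists u.
have := card_residues A s0; have := card_residues A q0; rewrite -/a -/b.
move: (\sum_(p <- I) _)%N (#|` A|) (#|` dsum q s A A|) => S N F hb ha hS h.
(* Divide by the number of free residue pairs. *)
have h1 : ((a * b) * ((q + s) * N) <= (a * b) * (S + (a * b) * (q * s)))%N by lia.
have h2 : ((q + s) * N <= S + (a * b) * (q * s))%N.
  by rewrite leq_pmul2l // muln_gt0 a0 in h1.
apply: leq_trans h2 _; apply: leq_add => //.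
by rewrite leq_mul2r [(q * s)%N]mulnC leq_mul ?orbT.
Qed.
End FullLifts.

(** * The one-dimensional bound *)

Lemma foldr_gcdz_dvd (r : seq int) x : x \in r -> (foldr gcdz 0 r %| x)%Z.
Proof.
elim: r => //= y r IH; rewrite inE => /predU1P[->|/IH h]; first exact: dvdz_gcdl.
exact: dvdz_trans (dvdz_gcdr _ _) h.
Qed.

(** Bezout: a subgroup that contains some integers contains their gcd. *)
Lemma foldr_gcdz_mem (S : int -> Prop) (r : seq int) : S 0 ->
  (forall x y, S x -> S y -> S (x + y)) -> (forall x, S x -> S (- x)) ->
  (forall x, x \in r -> S x) -> S (foldr gcdz 0 r).
Proof.
move=> S0 SD SN.
have SM (n : int) x : S x -> S (n * x).
  move=> Sx; have Sn (m : nat) : S (m%:Z * x).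
    elim: m => [|m IH]; first by rewrite mul0r.
    by rewrite -addn1 PoszD mulrDl mul1r; exact: SD.
  by case: n => m //; rewrite NegzE mulNr; apply: SN.
elim: r => //= y r IH h.
have [u [v <-]] := Bezoutz y (foldr gcdz 0 r).
apply: SD; apply: SM; first by apply: h; rewrite mem_head.
by apply: IH => x xr; apply: h; rewrite inE xr orbT.
Qed.

(** Subtract an element of A and divide by the gcd of the differences; sums of
dilates change by an injective affine map. *)
Lemma exists_normalised q s (A : {fset int}) : (1 < #|` A|)%N ->
  exists A' : {fset int}, [/\ normalised A', #|` A'| = #|` A| &
    #|` dsum q s A' A'| = #|` dsum q s A A|].
Proof.
move=> cA.
have [a0 a0A] : exists a0, a0 \in A by apply/fset0Pn; rewrite -cardfs_gt0 ltnW.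
pose r := [seq b - a0 | b <- A]; pose g := foldr gcdz 0 r.
have gd b : b \in A -> (g %| b - a0)%Z.
  by move=> bA; apply: foldr_gcdz_dvd; apply/mapP; exists b.
have [a1] : exists a1, a1 \in A `\ a0.
  by apply/fset0Pn; rewrite -cardfs_gt0; move: cA; rewrite (cardfsD1 a0) a0A.
rewrite !inE => /andP[a10 a1A].
have g0 : g != 0.
  by apply: contraNneq a10 => g0; move: (gd _ a1A); rewrite g0 dvd0z subr_eq0.
pose f b := ((b - a0) %/ g)%Z.
have fK b : b \in A -> b = a0 + g * f b.
  by move=> bA; rewrite mulrC divzK ?gd // addrC subrK.
pose A' := [fset f b | b in A].
have cA' : #|` A'| = #|` A|.
  by rewrite card_in_imfset // => x y xA yA e; rewrite (fK x) // (fK y) // e.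
exists A'; split=> //.
  split; first by apply/imfsetP; exists a0; rewrite // /f subrr div0z.
  move=> S S0 SD SN SA.
  have Sg : exists2 k, g = g * k & S k.
    apply: (@foldr_gcdz_mem (fun x => exists2 k, x = g * k & S k)).
    - by exists 0; rewrite ?mulr0.
    - by move=> _ _ [k -> Sk] [l -> Sl]; exists (k + l); rewrite ?mulrDr //; exact: SD.
    - by move=> _ [k -> Sk]; exists (- k); rewrite ?mulrN //; exact: SN.
    move=> _ /mapP[b bA ->]; exists (f b); first by rewrite {1}(fK b) // addrC addKr.
    by apply: SA; apply/imfsetP; exists b.
  case: Sg => k e Sk; have k1 : k = 1.
    by apply: (mulfI g0); rewrite -e mulr1.
  rewrite k1 in Sk => n.
  have Sn (m : nat) : S m%:Z.
    by elim: m => [//|m IH]; rewrite -addn1 PoszD; exact: SD.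
  by case: n => m //; rewrite NegzE; apply: SN.
have inj : injective (fun z : int => a0 *+ q + a0 *+ s + g * z).
  by move=> x y /addrI /(mulfI g0).
rewrite -(card_imfset imfset_key (mem (dsum q s A' A')) inj).
congr #|` _|; apply/fsetP => z.
have e a b : (a0 + g * a) *+ q + (a0 + g * b) *+ s
    = a0 *+ q + a0 *+ s + g * (a *+ q + b *+ s).
  by rewrite !mulrnDl mulrDr !mulrnAr addrACA.
apply/imfsetP/dsumP.
  move=> [_ /= /dsumP[_ /imfsetP[a /= aA ->] [_ /imfsetP[b /= bA ->] ->]] ->].
  by exists a => //; exists b => //; rewrite -e -!fK.
move=> [a aA [b bA ->]]; exists (f a *+ q + f b *+ s) => /=; last by rewrite -e -!fK.
by apply: mem_dsum; apply/imfsetP; [exists a|exists b].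
Qed.

Section OneDim.
Variables q s : nat.
Hypotheses (q0 : (0 < q)%N) (s0 : (0 < s)%N) (co : coprime q s).
Let tfz := @num_torsion_free int.

(* Classes with less than a proportion [1 / (2 (q + s))] of A count as small, and
   classes modulo [q s] with less than [1 / E], which is smaller by a factor
   [2 (q + s)]; each step then raises the coefficient by [1 / E]. *)
Let E := (4 * (q + s) * (q + s))%N.

(** If one class modulo s is much smaller than A, removing it costs little in
[k |A|] while [|A|] sums disappear. *)
Lemma small_class_gain q' s' k B (A : {fset int}) a0 :
  (0 < q')%N -> (0 < s')%N -> coprime q' s' -> (q' + s' = q + s)%N ->
  (k <= E * (q + s))%N ->
  (forall A : {fset int}, k * #|` A| <= E * #|` dsum q' s' A A| + B)%N ->
  a0 \in A -> (#|` residue_class s' (a0 %% s'%:Z)%Z A| * (2 * (q + s)) < #|` A|)%N ->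
  ((k + 1) * #|` A| <= E * #|` dsum q' s' A A| + B)%N.
Proof.
move=> q'0 s'0 co' e kE IH a0A small.
have := card_dsum_remove_class q'0 s'0 co' a0A; have := IH (A `\` residue_class s' (a0 %% s'%:Z)%Z A).
have := cardfsDS (residue_class_sub s' (a0 %% s'%:Z)%Z A).
have := fsubset_leq_card (residue_class_sub s' (a0 %% s'%:Z)%Z A).
move: small.
move: (#|` residue_class _ _ _|) (#|` A|) (#|` _ `\` _|) (#|` dsum _ _ A A|) (#|` dsum _ _ _ _|).
move=> c N D F F' h1 h2 h3 h4 h5.
have E2 : (2 <= E)%N by rewrite /E; nia.
have h6 : (2 * k * c <= E * N)%N.
  apply: (@leq_trans (E * (c * (2 * (q + s))))); last by rewrite leq_mul2l ltnW ?orbT.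
  have := leq_mul kE (leqnn c); lia.
have h7 : (E * (F' + N) <= E * F)%N by rewrite leq_mul2l h5 orbT.
have h8 : (2 * N <= E * N)%N by rewrite leq_mul2r E2 orbT.
have h9 : (k * D = k * N - k * c)%N by rewrite h3 mulnBr.
move: h6 h7 h8 h4; rewrite h9 mulnDr mulnDl mul1n -mulnA.
move: (E * N)%N (E * F)%N (E * F')%N (k * N)%N (k * c)%N => *; lia.
Qed.

(** A normalised set falls into one of four cases: some class modulo s or modulo q
is small; some class modulo [q s] is small although the classes containing it are
large; some class misses a lift, which adds a class of positive proportion; or
all lifts are met and the bound holds with coefficient [q + s]. *)
Lemma one_dim_step k B : (k < E * (q + s))%N ->
  (forall A : {fset int}, k * #|` A| <= E * #|` dsum q s A A| + B)%N ->
  exists B', forall A : {fset int},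
    ((k + 1) * #|` A| <= E * #|` dsum q s A A| + B')%N.
Proof.
move=> kE IH; have IH' (A : {fset int}) : (k * #|` A| <= E * #|` dsum s q A A| + B)%N.
  by rewrite dsumC.
have co' : coprime s q by rewrite coprime_sym.
exists (B + q * s * B + E * (q * s * (q * s)) + k + 1)%N => A.
have [cA|cA] := leqP #|` A| 1; first by case: #|` A| cA => [|[|n]] // _; lia.
have [A' [nA <- <-]] := exists_normalised q s cA; move: A' nA {A cA} => A nA.
have A0 : A != fset0 by apply/fset0Pn; exists 0; case: nA.
suff: [\/ (k + 1) * #|` A| <= E * #|` dsum q s A A| + B,
    (k + 1) * #|` A| <= E * #|` dsum q s A A| + q * s * B |
    E * ((q + s) * #|` A|) <= E * (#|` dsum q s A A| + (q * s * (q * s)))]%N.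
  case=> h; last have := leq_mul kE (leqnn #|` A|); lia.
(* Remove a small class modulo s or modulo q. *)
have [[a0 a0A h]|H1] := EM (exists2 a0, a0 \in A &
    (#|` residue_class s (a0 %% s%:Z)%Z A| * (2 * (q + s)) < #|` A|)%N).
  by constructor 1; apply: (small_class_gain q0 s0 co _ (ltnW kE) IH a0A h).
have [[a0 a0A h]|H2] := EM (exists2 a0, a0 \in A &
    (#|` residue_class q (a0 %% q%:Z)%Z A| * (2 * (q + s)) < #|` A|)%N).
  constructor 1; rewrite dsumC.
  by apply: (small_class_gain s0 q0 co' _ (ltnW kE) IH' a0A h); rewrite addnC.
(* A small class modulo [q s] inside a large class: its pair of classes still
   has many sums. *)
have [[p pI h]|H3] := EM (exists2 p, p \in residue_pairs q s A &
    (#|` bi_class q s A p| * E < #|` A|)%N).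
  constructor 2; apply: (class_dsum_gain q0 s0 co IH pI).
  case/residue_pairsP: pI => a aA [b bA pE].
  have hc : (#|` A| <= #|` residue_class s p.1 A| * (2 * (q + s)))%N.
    by rewrite leqNgt; apply/negP => hh; apply: H1; exists a => //; move: hh; rewrite pE.
  have hG : (#|` residue_class s p.1 A| <= #|` class_dsum q s A p|)%N.
    apply: (card_dsum_l tfz) => //; apply/fset0Pn; exists b; rewrite in_residue_class bA pE /=.
    by rewrite eqxx.
  have h1 : (k * #|` bi_class q s A p| <= (q + s) * #|` A|)%N.
    apply: (@leq_trans (E * (q + s) * #|` bi_class q s A p|)).
      by rewrite leq_mul2r ltnW ?orbT.
    rewrite -mulnA mulnCA leq_mul2l; apply/orP; right; rewrite mulnC; exact: ltnW.
  have h2 : (2 * (q + s) * #|` A| <= E * #|` class_dsum q s A p|)%N.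
    apply: (@leq_trans (E * #|` residue_class s p.1 A|)); last by rewrite leq_mul2l hG orbT.
    rewrite /E; have := leq_mul (leqnn (2 * (q + s))) hc; lia.
  move: h1 h2; move: (k * _)%N (E * _)%N (#|` A|) => x y N; clear -q0; nia.
have H3' p : p \in residue_pairs q s A -> (#|` A| <= #|` bi_class q s A p| * E)%N.
  by move=> pI; rewrite leqNgt; apply/negP => hh; apply: H3; exists p.
have ne p : p \in residue_pairs q s A -> bi_class q s A p != fset0.
  by move=> /H3'; apply: contraTneq => ->; rewrite cardfs0 mul0n -ltnNge cardfs_gt0.
(* A missing lift modulo [s ^ 2], and then, exchanging the roles of q and s,
   modulo [q ^ 2]. *)
have [[p pI nl]|H4] := EM (exists2 p, p \in residue_pairs q s A &
    ~ meets_all_lifts s (bi_class q s A p)).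
  constructor 2; apply: (class_dsum_gain q0 s0 co IH pI).
  have [p' p'I gain] := missing_lift_gain s0 co nA ne pI nl.
  have := H3' _ p'I; have := IH (bi_class q s A p).
  have := leq_mul (leqnn E) gain; rewrite mulnDr.
  rewrite [X in (_ <= X -> _)%N]mulnC; lia.
have [[p pI nl]|H5] := EM (exists2 p, p \in residue_pairs q s A &
    ~ meets_all_lifts q (bi_class q s A p)).
  constructor 2; apply: (class_dsum_gain q0 s0 co IH pI).
  pose sw (p : int * int) := (p.2, p.1).
  have swI p' : (sw p' \in residue_pairs s q A) = (p' \in residue_pairs q s A).
    by rewrite !in_fsetM andbC.
  have swp p' : bi_class s q A (sw p') = bi_class q s A p'.
    by apply/fsetP => x; rewrite !in_bi_class /= [X in _ && X]andbC.
  have swK p' : sw (sw p') = p' by case: p'.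
  have [|||p' p'I] := @missing_lift_gain s q q0 co' A (sw p) nA.
  - by move=> p' p'I; rewrite -[p']swK swp ne // -swI swK.
  - by rewrite swI.
  - by rewrite swp.
  rewrite -[p']swK !swp dsumC => gain.
  have {}gain : (#|` dsum q s (bi_class q s A p) (bi_class q s A p)|
      + #|` bi_class q s A (sw p')| <= #|` class_dsum q s A p|)%N.
    have -> : class_dsum q s A p = class_dsum s q A (sw p) by rewrite /class_dsum dsumC.
    exact: gain.
  have := H3' (sw p'); rewrite -swI swK => /(_ p'I).
  have := IH (bi_class q s A p).
  have := leq_mul (leqnn E) gain; rewrite mulnDr.
  rewrite [X in (_ <= X -> _)%N]mulnC; lia.
constructor 3; rewrite leq_mul2l; apply/orP; right.
apply: all_lifts_bound => // p pI; split; first exact: ne.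
  by apply: contrapT => nl; apply: H4; exists p.
by apply: contrapT => nl; apply: H5; exists p.
Qed.

Theorem one_dim : exists B, forall A : {fset int},
  ((q + s) * #|` A| <= #|` dsum q s A A| + B)%N.
Proof.
have H k : (k <= E * (q + s))%N -> exists B, forall A : {fset int},
    (k * #|` A| <= E * #|` dsum q s A A| + B)%N.
  elim: k => [_|k IH kE]; first by exists 0%N => A.
  have [B hB] := IH (ltnW kE); have [B' hB'] := one_dim_step kE hB.
  by exists B' => A; rewrite -addn1.
have [B hB] := H _ (leqnn _); exists B => A.
have E0 : (0 < E)%N by rewrite /E; nia.
rewrite -(leq_pmul2l E0) mulnA (leq_trans (hB A)) // mulnDr leq_add2l.
by rewrite leq_pmull.
Qed.
End OneDim.

(** * Petridis lemma, Ruzsa triangle and covering inequalities *)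

Section Sumsets.
Variable V : zmodType.
Implicit Types A B U W X Y Z D : {fset V}.

Lemma card_sumset_le A B : (#|` sumset A B| <= #|` A| * #|` B|)%N.
Proof.
rewrite -cardfsM; have -> : sumset A B = [fset p.1 + p.2 | p in A `*` B].
  apply/fsetP => z; apply/sumsetP/imfsetP.
    by move=> [a aA [b bB ->]]; exists (a, b); rewrite // !inE aA bB.
  move=> [[a b] /=]; rewrite !inE => /andP[/= aA bB] ->.
  by exists a => //; exists b.
exact: leq_imfset_card.
Qed.

Lemma sumset0 A : sumset A [fset 0] = A.
Proof.
apply/fsetP => z; apply/sumsetP/idP.
  by move=> [a aA [b]]; rewrite inE => /eqP-> ->; rewrite addr0.
by move=> zA; exists z => //; exists 0; rewrite ?inE ?addr0.
Qed.

Lemma sumsetA A B Z : sumset (sumset A B) Z = sumset A (sumset B Z).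
Proof.
apply/fsetP => z; apply/sumsetP/sumsetP.
  move=> [_ /sumsetP[a aA [b bB ->]] [c cZ ->]]; exists a => //.
  by exists (b + c); rewrite ?mem_sumset // addrA.
move=> [a aA [_ /sumsetP[b bB [c cZ ->]] ->]]; exists (a + b); rewrite ?mem_sumset //.
by exists c => //; rewrite addrA.
Qed.

(** Adding one element z to Z. Let W be the set of y in Y for which [y + B + z] is
already in [Y + B + Z]. Then [Y + B + Z] grows by at most [|Y + B| - |W + B|] and
[Y + Z] by at least [|Y| - |W|], and the minimality of Y compares the two. *)
Lemma petridis_step Y B Z z :
  (forall W, W `<=` Y -> #|` sumset Y B| * #|` W| <= #|` sumset W B| * #|` Y|)%N ->
  (#|` sumset (sumset Y B) Z| * #|` Y| <= #|` sumset Y B| * #|` sumset Y Z|)%N ->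
  (#|` sumset (sumset Y B) (z |` Z)| * #|` Y|
     <= #|` sumset Y B| * #|` sumset Y (z |` Z)|)%N.
Proof.
move=> Ymin IH.
pose W := [fset y in Y | all (fun b => y + b + z \in sumset (sumset Y B) Z) B].
have WY : W `<=` Y by apply/fsubsetP => y; rewrite !inE => /andP[].
have WB : sumset W B `<=` sumset Y B.
  apply/fsubsetP => _ /sumsetP[y /(fsubsetP WY) yY [b bB ->]]; exact: mem_sumset.
have addI : injective (fun x : V => x + z) by exact: addIr.
have h1 : (#|` sumset (sumset Y B) (z |` Z)| <=
    #|` sumset (sumset Y B) Z| + (#|` sumset Y B| - #|` sumset W B|))%N.
  rewrite -(cardfsDS WB) -(card_imfset imfset_key (mem (sumset Y B `\` sumset W B)) addI).
  rewrite -cardfsUI (leq_trans _ (leq_addr _ _)) //; apply: fsubset_leq_card.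
  apply/fsubsetP => _ /sumsetP[x xYB [y + ->]]; rewrite !inE => /orP[/eqP->|yZ].
    have [/sumsetP[w wW [b bB ->]]|xW] := boolP (x \in sumset W B).
      by move: wW; rewrite !inE => /andP[_ /allP/(_ b bB)->].
    by apply/orP; right; apply/imfsetP; exists x; rewrite //= !inE xW.
  by rewrite mem_sumset.
have h2 : (#|` sumset Y Z| + (#|` Y| - #|` W|) <= #|` sumset Y (z |` Z)|)%N.
  rewrite -(cardfsDS WY) -(card_imfset imfset_key (mem (Y `\` W)) addI).
  rewrite -cardfsUI [X in (_ + X)%N](_ : _ = 0%N) ?addn0.
    apply: fsubset_leq_card; rewrite fsubUset; apply/andP; split.
      apply/fsubsetP => _ /sumsetP[y yY [x xZ ->]]; apply: mem_sumset => //.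
      by rewrite !inE xZ orbT.
    apply/fsubsetP => x /imfsetP[y /=]; rewrite !inE => /andP[_ yY] ->.
    by apply: mem_sumset => //; rewrite !inE eqxx.
  apply/eqP; rewrite cardfs_eq0; apply/eqP/fsetP => x; rewrite !inE.
  apply/negP => /andP[/sumsetP[y' y'Y [z' z'Z ->]] /imfsetP[y /=]].
  rewrite !inE => /andP[yW yY] e; move: yW; rewrite yY /=.
  move=> /negP; apply; apply/allP => b bB.
  by rewrite addrAC -e addrAC; apply: mem_sumset => //; exact: mem_sumset.
have h3 := Ymin W WY.
have h4 := fsubset_leq_card WY; have h5 := fsubset_leq_card WB.
move: h1 h2 h3 h4 h5 IH.
move: (#|` sumset Y B|) (#|` sumset W B|) (#|` W|) (#|` Y|) (#|` sumset Y Z|)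
  (#|` sumset Y (z |` Z)|) (#|` sumset (sumset Y B) Z|)
  (#|` sumset (sumset Y B) (z |` Z)|) => a b c d e f g h.
move=> h1 h2 h3 h4 h5 IH; clear -h1 h2 h3 h4 h5 IH.
have : (h * d <= (g + (a - b)) * d)%N by rewrite leq_mul2r h1 orbT.
have : (a * (e + (d - c)) <= a * f)%N by rewrite leq_mul2l h2 orbT.
rewrite mulnDr mulnDl mulnBr mulnBl.
have : (b * d <= a * d)%N by rewrite leq_mul2r h5 orbT.
have : (a * c <= a * d)%N by rewrite leq_mul2l h4 orbT.
lia.
Qed.

(** Petridis's form of the Pluennecke inequality: Y is a nonempty subset of A that
minimises the ratio [|Y + B| / |Y|]. *)
Lemma petridis A B : A != fset0 -> exists Y,
  [/\ Y `<=` A, Y != fset0 & forall Z,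
  (#|` sumset (sumset Y B) Z| * #|` A| <= #|` sumset A B| * #|` sumset Y Z|)%N].
Proof.
move=> A0.
have AA : A \in fpowerset A by rewrite fpowersetE.
pose r (Y : fpowerset A) : rat := #|` sumset (val Y) B|%:R / #|` val Y|%:R.
case: (@Order.TotalTheory.arg_minP _ _ (fpowerset A) [` AA] (fun Y : fpowerset A => val Y != fset0) r A0).
move=> [Y YA'] /= Y0 Ymin; have YA : Y `<=` A by rewrite -fpowersetE.
have Ymin' W : W `<=` A -> (#|` sumset Y B| * #|` W| <= #|` sumset W B| * #|` Y|)%N.
  move=> WA; have [->|W0] := eqVneq W fset0; first by rewrite cardfs0 muln0.
  have WA' : W \in fpowerset A by rewrite fpowersetE.
  have := Ymin [` WA'] W0; rewrite /r /= ler_pdivrMr ?ltr0n ?cardfs_gt0 //.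
  by rewrite mulrAC ler_pdivlMr ?ltr0n ?cardfs_gt0 // -!natrM ler_nat.
exists Y; split=> // Z.
have key : (#|` sumset (sumset Y B) Z| * #|` Y| <= #|` sumset Y B| * #|` sumset Y Z|)%N.
  elim/fset1U_rect: Z => [|z Z _ IH]; last first.
    by apply: petridis_step => // W WY; apply: Ymin'; exact: fsubset_trans YA.
  by rewrite (_ : sumset _ fset0 = fset0) ?cardfs0 //; apply/fsetP => z;
    rewrite inE; apply/negP => /sumsetP[? _ [? +]]; rewrite inE.
have Y1 : (0 < #|` Y|)%N by rewrite cardfs_gt0.
rewrite -(leq_pmul2r Y1); move: key (Ymin' A (fsubset_refl _)); move: (#|` sumset (sumset Y B) Z|) (#|` Y|)
 (#|` sumset Y B|) (#|` sumset Y Z|) (#|` A|) (#|` sumset A B|) => a b c d e f h1 h2.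
have := leq_mul h1 (leqnn e); have := leq_mul h2 (leqnn d); lia.
Qed.

Definition diffset A B := [fset a - b | a in A, b in B].

Lemma diffsetP A B z :
  reflect (exists2 a, a \in A & exists2 b, b \in B & z = a - b)
          (z \in diffset A B).
Proof.
apply: (iffP idP).
  by move=> /imfset2P[a aA [b bB ->]]; exists a => //; exists b.
by move=> [a aA [b bB ->]]; apply/imfset2P; exists a => //; exists b.
Qed.

Lemma mem_diffset A B a b : a \in A -> b \in B -> a - b \in diffset A B.
Proof. by move=> aA bB; apply/diffsetP; exists a => //; exists b. Qed.

(** For fixed [u - w], the pairs [(y + u, y + w)] are [|Y|] pairs of elements of
[Y + U] and [Y + W] with that difference. *)
Lemma ruzsa_triangle U W Y :
  (#|` diffset U W| * #|` Y| <= #|` sumset Y U| * #|` sumset Y W|)%N.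
Proof.
rewrite -sum_const_fset -cardfsM.
pose G z := [fset p in sumset Y U `*` sumset Y W | p.1 - p.2 == z].
apply: leq_trans (card_disjoint_family (I := diffset U W) (G := G) _ _).
- rewrite big_seq [X in (_ <= X)%N]big_seq; apply: leq_sum => z.
  move=> /diffsetP[u uU [w wW ->]].
  apply: (@leq_card_inj _ _ (fun y => (y + u, y + w))).
    by move=> x y _ _ [/addIr].
  by move=> y yY; rewrite !inE /= !mem_sumset //= opprD addrACA subrr add0r.
- by move=> z _; apply/fsubsetP => p; rewrite !inE => /andP[].
- by move=> z z' p _ _; rewrite !inE => /andP[_ /eqP->] /andP[_ /eqP->].
Qed.

(** Take X maximal among the subsets of S for which the translates [x + A] are
disjoint: no further translate by an element of S can be disjoint from them. *)
Lemma ruzsa_covering A S K : A != fset0 ->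
  (#|` sumset S A| <= K * #|` A|)%N ->
  exists X, [/\ X `<=` S, (#|` X| <= K)%N &
    forall t, t \in S -> exists2 x, x \in X & t - x \in diffset A A].
Proof.
move=> A0 hK; pose D := diffset A A.
pose dis (X : {fset V}) := all (fun x => all (fun y => (x - y \in D) ==> (x == y)) X) X.
have SS : fset0 \in fpowerset S by rewrite fpowersetE.
case: (@Order.TotalTheory.arg_maxP _ _ (fpowerset S) [` SS] (fun X : fpowerset S => dis (val X))
  (fun X : fpowerset S => #|` val X|) isT).
move=> [X XS'] /= dX Xmax; have XS : X `<=` S by rewrite -fpowersetE.
exists X; split=> //.
  have A1 : (0 < #|` A|)%N by rewrite cardfs_gt0.
  rewrite -(leq_pmul2r A1); apply: leq_trans hK.
  rewrite -sum_const_fset.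
  apply: leq_trans (card_disjoint_family (I := X) (G := fun x => [fset x + a | a in A]) _ _).
  - by apply: leq_sum => x _; rewrite card_imfset // => a b /addrI.
  - move=> x xX; apply/fsubsetP => _ /imfsetP[a /= aA ->].
    by apply: mem_sumset => //; exact: (fsubsetP XS).
  move=> x y z xX yX /imfsetP[a /= aA ->] /imfsetP[b /= bA e].
  apply/eqP; have /allP/(_ x xX)/allP/(_ y yX)/implyP := dX; apply.
  rewrite (_ : x - y = b - a) ?mem_diffset //.
  by apply/eqP; rewrite subr_eq addrAC eq_sym subr_eq e addrC.
move=> t tS; apply: contrapT => H.
have nt x : x \in X -> (t - x \in D) = false.
  by move=> xX; apply/negP => h; apply: H; exists x.
have DN x y : (x - y \in D) = (y - x \in D).
  by apply/diffsetP/diffsetP => -[a aA [b bA e]]; exists b => //; exists a => //;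
    rewrite -[LHS]opprB e opprB.
have tX : t \notin X.
  apply/negP => /nt; rewrite subrr => /negP; apply.
  by have /fset0Pn[a aA] := A0; apply/diffsetP; exists a => //; exists a; rewrite ?subrr.
have XtS : t |` X \in fpowerset S by rewrite fpowersetE fsubUset fsub1set tS.
suff: dis (t |` X).
  by move=> /(Xmax [` XtS]) /=; rewrite cardfsU1 tX add1n leEnat ltnn.
apply/allP => x; rewrite !inE => xtX; apply/allP => y; rewrite !inE => ytX.
case/predU1P: xtX => [->|xX]; case/predU1P: ytX => [->|yX].
- by rewrite eqxx implybT.
- by rewrite nt.
- by rewrite DN nt.
by have /allP/(_ x xX)/allP/(_ y yX) := dX.
Qed.

End Sumsets.

(** * A set of small doubling lies on few parallel lines *)

Section Doubling.
Variables (V : zmodType) (D X : {fset V}).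
Hypothesis cover : forall d, d \in D -> exists2 x, x \in X & d + d - x \in D.

(** Approximating [2 ^ i e] by an element of D up to a translation, the next
translation is twice the previous one plus an element of X. So m successive
doublings of e are described by m elements of X, and two elements of a set with
more than [|X| ^ m] elements share their description. The function [f] is the
current approximation, and k the number of doublings already made. *)
Lemma doubling_pigeonhole m k (S : {fset V}) (f : V -> V) :
  (forall e, e \in S -> f e \in D) ->
  (forall e e', e \in S -> e' \in S -> f e - f e' = (e - e') *+ 2 ^ k) ->
  (#|` X| ^ m < #|` S|)%N ->
  exists e e', [/\ e \in S, e' \in S, e != e' &
    forall i, (i <= m)%N -> exists2 d, d \in D & exists2 d', d' \in D &
      (e - e') *+ 2 ^ (k + i) = d - d'].
Proof.
elim: m k S f => [|m IH] k S f fD fE.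
  rewrite expn0 => S1.
  have [e eS] : exists e, e \in S by apply/fset0Pn; rewrite -cardfs_gt0 ltnW.
  have [e' e'S] : exists e', e' \in S `\ e.
    by apply/fset0Pn; rewrite -cardfs_gt0; move: S1; rewrite (cardfsD1 e) eS.
  move: e'S; rewrite !inE => /andP[ne e'S].
  exists e, e'; split=> //; first by rewrite eq_sym.
  move=> i; rewrite leqn0 => /eqP->; exists (f e); first exact: fD.
  by exists (f e'); [exact: fD|rewrite addn0 fE].
move=> cS; pose Sx x := [fset e in S | f e + f e - x \in D].
have [x xX cx] : exists2 x, x \in X & (#|` X| ^ m < #|` Sx x|)%N.
  apply: contrapT => H; move: cS; rewrite ltnNge => /negP; apply.
  apply: leq_trans (sum_cover_ge (fun e eS => cover (fD e eS))) _.
  rewrite expnS -sum_const_fset big_seq [X in (_ <= X)%N]big_seq.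
  apply: leq_sum => x xX; rewrite leqNgt; apply/negP => h.
  by apply: H; exists x.
have SxS e : e \in Sx x -> e \in S by rewrite !inE => /andP[].
have [||e [e' [eS e'S ne H]]] := IH k.+1 (Sx x) (fun e => f e + f e - x) _ _ cx.
- by move=> e; rewrite !inE => /andP[].
- move=> e e' /SxS eS /SxS e'S.
  rewrite opprB addrA subrK opprD addrACA fE // -mulrnDr addnn -mul2n -expnS //.
exists e, e'; split; [exact: SxS|exact: SxS|done|].
case=> [_|i im].
  exists (f e); first by apply/fD/SxS.
  by exists (f e'); [exact/fD/SxS|rewrite addn0 fE //; exact: SxS].
by rewrite addnS -addSn; exact: H.
Qed.
End Doubling.

Fixpoint nsum (V : zmodType) (k : nat) (D : {fset V}) : {fset V} :=
  if k is k'.+1 then sumset D (nsum k' D) else [fset 0].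

(** Binary expansion of the multiplier; each digit costs two elements of D. *)
Lemma mulrn_nsum (V : zmodType) (D : {fset V}) (w : V) m :
  0 \in D -> (forall d, d \in D -> - d \in D) ->
  (forall i, (i <= m)%N -> exists2 d, d \in D & exists2 d', d' \in D &
      w *+ 2 ^ i = d - d') ->
  forall r j, (r <= m)%N -> (j < 2 ^ r)%N -> w *+ j \in nsum (r.*2) D.
Proof.
move=> D0 DN H; elim=> [|r IH] j rm; first by case: j => //; rewrite inE.
move=> jr /=; have [j1|j1] := ltnP j (2 ^ r).
  rewrite -[_ *+ _]add0r; apply: mem_sumset => //.
  by rewrite -[_ *+ _]add0r; apply: mem_sumset => //; apply: IH => //; exact: ltnW.
have [d dD [d' d'D e]] := H r (ltnW rm).
rewrite -(subnKC j1) mulrnDr e -addrA; apply: mem_sumset => //; apply: mem_sumset.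
  exact: DN.
by apply: IH; [exact: ltnW|rewrite ltn_subLR // addnn -mul2n -expnS].
Qed.

(** All combinations of the elements of X with coefficients at most k. *)
Fixpoint multiples_box (V : zmodType) (k : nat) (X : seq V) : {fset V} :=
  if X is x :: X' then sumset [fset x *+ i | i in iota 0 k.+1] (multiples_box k X')
  else [fset 0].

Lemma card_multiples_box (V : zmodType) k (X : seq V) : (#|` multiples_box k X| <= k.+1 ^ size X)%N.
Proof.
elim: X => [|x X IH] /=; first by rewrite cardfs1.
apply: leq_trans (card_sumset_le _ _) _; rewrite expnS leq_mul //.
apply: leq_trans (leq_imfset_card _ _ _) _.
by apply: leq_trans (size_undup _) _; rewrite /= size_iota.
Qed.

Lemma mem_multiples_box (V : zmodType) k (X : seq V) (c : V -> nat) :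
  (forall x, (c x <= k)%N) -> \sum_(x <- X) x *+ c x \in multiples_box k X.
Proof.
move=> ck; elim: X => [|x X IH] /=; first by rewrite big_nil inE.
rewrite big_cons; apply: mem_sumset => //; apply/imfsetP; exists (c x) => //=.
by rewrite -[_ :: _]/(iota 0 k.+1) mem_iota /= ltnS.
Qed.

Section Growth.
Variables (V : zmodType) (D X : {fset V}).
Hypothesis D0 : 0 \in D.
Hypothesis cover : forall d d', d \in D -> d' \in D ->
  exists2 x, x \in X & d + d' - x \in D.

(** Each addition of an element of D is absorbed at the price of one element of X,
and only the number of times each of them is used matters. Hence iterated sums
grow polynomially in k. *)
Lemma nsum_decomp k z : z \in nsum k D -> exists c : V -> nat,
  (forall x, (c x <= k)%N) /\ z - \sum_(x <- X) x *+ c x \in D.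
Proof.
elim: k z => [|k IH] z /=.
  rewrite inE => /eqP->; exists (fun=> 0%N); split=> //.
  by rewrite big1 ?subr0.
move=> /sumsetP[d dD [z' /IH[c [ck cD]] ->]].
have [x xX e] := cover dD cD.
exists (fun y => c y + (y == x))%N; split=> [y|].
  by rewrite -addn1 leq_add // leq_b1.
have -> : \sum_(y <- X) y *+ (c y + (y == x)) = \sum_(y <- X) y *+ c y + x.
  under eq_bigr do rewrite mulrnDr.
  rewrite big_split /=; congr (_ + _); rewrite (big_fsetD1 x) //= eqxx mulr1n.
  rewrite big_seq big1 ?addr0 // => y.
  by rewrite !inE => /andP[/negPf-> _].
by move: e; rewrite opprD !addrA.
Qed.

Lemma card_sumset_nsum A k :
  (#|` sumset A (nsum k D)| <= k.+1 ^ #|` X| * #|` sumset A D|)%N.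
Proof.
apply: (@leq_trans #|` sumset (multiples_box k X) (sumset A D)|).
  apply: fsubset_leq_card; apply/fsubsetP => _ /sumsetP[a aA [z /nsum_decomp[c [ck cD]] ->]].
  rewrite -(subrK (\sum_(x <- X) x *+ c x) z) addrA addrC.
  by apply: mem_sumset; [exact: mem_multiples_box|exact: mem_sumset].
by apply: leq_trans (card_sumset_le _ _) _; rewrite leq_mul2r card_multiples_box orbT.
Qed.
End Growth.

(** A polynomial bound for the growth is negligible against an exponential; the
constants are crude but explicit so that they depend on a only. *)
Lemma poly_le_exp a n : (0 < a)%N -> ((4 * n).+1 ^ a <= (4 * a) ^ a * 2 ^ n)%N.
Proof.
move=> a0; have h1 : (n < a * (n %/ a).+1)%N by rewrite mulnC ltn_ceil.
have h2 : (n %/ a < 2 ^ (n %/ a))%N by exact: ltn_expl.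
have h3 : ((4 * n).+1 <= 4 * a * 2 ^ (n %/ a))%N.
  apply: (@leq_trans (4 * (a * (n %/ a).+1))); first by lia.
  by rewrite mulnA leq_mul2l h2 orbT.
apply: leq_trans (_ : (4 * a * 2 ^ (n %/ a)) ^ a <= _)%N; first by rewrite leq_exp2r.
rewrite expnMn leq_mul2l -expnM; apply/orP; right; rewrite leq_exp2l //.
exact: leq_trunc_div.
Qed.

Lemma subr_add_regroup (V : zmodType) (a b c d e : V) :
  a - b + (c - d) + e = (a + (c + e)) - (b + d).
Proof. by rewrite [a - b + (c - d)]addrACA -opprD [LHS]addrAC addrA. Qed.

Section FewLines.
Variable V : zmodType.
Hypothesis tf : torsion_free V.

Lemma mulrn_exponent_injective (w : V) : w != 0 -> injective (fun i => w *+ i).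
Proof.
move=> w0; suff H i j : (i <= j)%N -> w *+ i = w *+ j -> i = j.
  move=> i j e; case: (leqP i j) => [/H->//|/ltnW/H->//].
move=> ij e; have [/eqP h|h] := posnP (j - i).
  by apply/eqP; rewrite eqn_leq ij -subn_eq0.
by case/eqP: w0; apply: (tf h); rewrite mulrnBr // e subrr.
Qed.

(** Petridis's lemma applied to [q A] and [s A] bounds the sum of Y with two and with
three copies of [s A]; the Ruzsa triangle inequality then bounds [3 A - 2 A], which
is the set below. *)
Lemma plunnecke_ruzsa q s C (A : {fset V}) : (0 < q)%N -> (0 < s)%N ->
  A != fset0 -> (#|` dsum q s A A| <= C * #|` A|)%N ->
  (#|` sumset (sumset (diffset A A) (diffset A A)) A| <= C ^ 5 * #|` A|)%N.
Proof.
move=> q0 s0 A0 hC.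
pose Q := [fset a *+ q | a in A]; pose B := [fset a *+ s | a in A].
have cQ : #|` Q| = #|` A| by rewrite card_imfset //; exact: (mulrn_injective tf).
have eQB : sumset Q B = dsum q s A A.
  apply/fsetP => z; apply/sumsetP/dsumP.
    by move=> [_ /imfsetP[a /= aA ->] [_ /imfsetP[b /= bA ->] ->]]; exists a => //; exists b.
  move=> [a aA [b bA ->]]; exists (a *+ q); first by apply/imfsetP; exists a.
  by exists (b *+ s) => //; apply/imfsetP; exists b.
have Q0 : Q != fset0 by rewrite -cardfs_gt0 cQ cardfs_gt0.
have [Y [YQ Y0 H]] := petridis B Q0.
have A1 : (0 < #|` A|)%N by rewrite cardfs_gt0.
have Y1 : (0 < #|` Y|)%N by rewrite cardfs_gt0.
have {}H Z : (#|` sumset (sumset Y B) Z| <= C * #|` sumset Y Z|)%N.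
  rewrite -(leq_pmul2r A1) -{1}cQ (leq_trans (H Z)) // eQB mulnAC.
  by rewrite leq_mul2r hC orbT.
have H1 : (#|` sumset Y B| <= C * #|` Y|)%N.
  by have := H [fset 0]; rewrite !sumset0.
have H2 : (#|` sumset Y (sumset B B)| <= C * (C * #|` Y|))%N.
  by rewrite -sumsetA (leq_trans (H B)) // leq_mul2l H1 orbT.
have H3 : (#|` sumset Y (sumset B (sumset B B))| <= C * (C * (C * #|` Y|)))%N.
  by rewrite -sumsetA (leq_trans (H _)) // leq_mul2l H2 orbT.
have T := ruzsa_triangle (sumset B (sumset B B)) (sumset B B) Y.
have {}T : (#|` diffset (sumset B (sumset B B)) (sumset B B)| <= C ^ 5 * #|` A|)%N.
  apply: (@leq_trans (C ^ 5 * #|` Y|)); last first.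
    by rewrite leq_mul2l -cQ fsubset_leq_card ?orbT.
  rewrite -(leq_pmul2r Y1) (leq_trans T) // (leq_trans (leq_mul H3 H2)) //.
  by rewrite !expnS expn0; lia.
apply: leq_trans T; apply: (@leq_card_inj _ _ (fun x => x *+ s)).
  by move=> x y _ _; exact: (mulrn_injective tf).
move=> _ /sumsetP[_ /sumsetP[_ /diffsetP[a1 a1A [b1 b1A ->]]
  [_ /diffsetP[a2 a2A [b2 b2A ->]] ->]] [a aA ->]].
have -> : (a1 - b1 + (a2 - b2) + a) *+ s =
    (a1 *+ s + (a2 *+ s + a *+ s)) - (b1 *+ s + b2 *+ s).
  rewrite !mulrnDl !mulNrn; exact: subr_add_regroup.
have mB x : x \in A -> x *+ s \in B by move=> xA; apply/imfsetP; exists x.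
by apply: mem_diffset; do ?[apply: mem_sumset]; exact: mB.
Qed.

End FewLines.

(** Here w is the common direction, [2 ^ m] is at least a constant times a fixed power
of [|A|], and S runs over sets with at most one point on each line. By [doubling_pigeonhole]
there is w with [4 ^ m] multiples in an iterated sum of [A - A] of length O(m).
Those multiples of w and S have distinct sums, which lie in a set of
size at most [O(2 ^ m) |A|]. *)
Lemma few_lines q s C : (0 < q)%N -> (0 < s)%N -> exists M K,
  forall V : zmodType, torsion_free V ->
  forall A : {fset V}, (1 < #|` A|)%N -> (#|` dsum q s A A| <= C * #|` A|)%N ->
  exists2 w : V, w != 0 & exists2 m, (#|` A| <= M ^ m.+1)%N &
    forall S, S `<=` A ->
      (forall a a' i j, a \in S -> a' \in S -> a + w *+ i = a' + w *+ j -> a = a') ->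
      (#|` S| * 2 ^ m <= K * #|` A|)%N.
Proof.
move=> q0 s0; pose c := (C ^ 5)%N; pose M0 := maxn 2 c.
have M01 : (1 < M0)%N by rewrite leq_max.
exists (M0 * M0)%N, ((4 * M0) ^ M0 * c)%N => V tf A cA hC.
have A0 : A != fset0 by rewrite -cardfs_gt0 ltnW.
have DDA := plunnecke_ruzsa tf q0 s0 A0 hC.
pose D := diffset A A; rewrite -/D -/c in DDA.
have [X [_ cX cov]] := ruzsa_covering A0 DDA.
have {}cov d d' : d \in D -> d' \in D -> exists2 x, x \in X & d + d' - x \in D.
  by move=> dD d'D; apply: cov; exact: mem_sumset.
have [a0 a0A] : exists a0, a0 \in A by apply/fset0Pn.
have D0 : 0 \in D by rewrite -(subrr a0); exact: mem_diffset.
have DN d : d \in D -> - d \in D.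
  by move=> /diffsetP[a aA [b bA ->]]; rewrite opprB; exact: mem_diffset.
have cXM : (#|` X| <= M0)%N by rewrite (leq_trans cX) // leq_maxr.
have AD : (#|` A| <= #|` D|)%N.
  apply: (@leq_card_inj _ _ (fun a => a - a0)); first by move=> x y _ _ /addIr.
  by move=> a aA; exact: mem_diffset.
have MM1 : (1 < M0 * M0)%N by rewrite (@leq_trans M0) // leq_pmulr // ltnW.
(* The base is squared so that [2 m] doublings can be afforded: the growth
   of the iterated sums then costs a factor [2 ^ m] out of [2 ^ (2 m)] multiples. *)
pose m := (up_log (M0 * M0) #|` A|).-1.
have /andP[lm um] := up_log_bounds MM1 cA.
rewrite -/m in lm.
have um' : (#|` A| <= (M0 * M0) ^ m.+1)%N.
  by rewrite /m prednK // up_log_gt0 MM1.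
have cXm : (#|` X| ^ (m.*2) < #|` D|)%N.
  apply: leq_trans AD; apply: leq_ltn_trans lm; rewrite mulnn -expnM mul2n.
  by case: (m.*2) => // n; rewrite leq_exp2r.
have [||e [e' [eD e'D ne H]]] :=
  @doubling_pigeonhole V D X (fun d dD => cov d d dD dD) m.*2 0 D id _ _ cXm.
- by [].
- by move=> *; rewrite expn0 mulr1n.
exists (e - e'); first by rewrite subr_eq0.
exists m => // S SA Sw; set w := e - e' in H Sw *.
have P := mulrn_nsum D0 DN H (leqnn _).
have h1 : (#|` S| * 2 ^ m.*2 <= #|` sumset A (nsum m.*2.*2 D)|)%N.
  have cI : #|` [fset x in iota 0 (2 ^ m.*2)]| = (2 ^ m.*2)%N.
    by rewrite card_fseq undup_id ?iota_uniq // size_iota.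
  rewrite -[X in (_ * X <= _)%N]cI -cardfsM.
  apply: (@leq_card_inj _ _ (fun p : V * nat => p.1 + w *+ p.2)).
    move=> [a i] [a' j]; rewrite !inE /= => /andP[aS _] /andP[a'S _] e1.
    have e2 := Sw _ _ _ _ aS a'S e1; move: e1; rewrite e2 => /addrI e3.
    by congr pair; apply: (mulrn_exponent_injective tf) e3; rewrite subr_eq0.
  move=> [a i]; rewrite !inE mem_iota /= => /andP[aS im].
  by apply: mem_sumset; [exact: (fsubsetP SA)|exact: P].
have h2 : (#|` sumset A (nsum m.*2.*2 D)| <= (4 * M0) ^ M0 * 2 ^ m * (c * #|` A|))%N.
  apply: leq_trans (card_sumset_nsum D0 cov A _) _; apply: leq_mul.
    apply: leq_trans (poly_le_exp m (ltnW M01)).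
    by rewrite -!mul2n mulnA leq_pexp2l.
  apply: leq_trans DDA; apply: fsubset_leq_card; apply/fsubsetP.
  move=> _ /sumsetP[a aA [d dD ->]]; rewrite addrC -[d]addr0.
  by apply: mem_sumset => //; exact: mem_sumset.
have p2 : (0 < 2 ^ m)%N by rewrite expn_gt0.
rewrite -(leq_pmul2r p2); move: (leq_trans h1 h2).
by rewrite -addnn expnD mulnA [X in (_ <= X -> _)%N]mulnAC mulnA.
Qed.

(** * A Delaunay graph on a finite set of points *)

Lemma exists_nonroot (F : realFieldType) (p : {poly F}) : p != 0 ->
  exists t, [/\ 0 < t, t < 1 & ~~ root p t].
Proof.
move=> p0; pose r := [seq (i.+2%:R)^-1 : F | i <- iota 0 (size p)].
have /allPn[t /mapP[i _ ->] nt] : ~~ all (root p) r.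
  apply/negP => /(max_poly_roots p0).
  rewrite /r size_map size_iota ltnn => /(_ _)/notF; apply.
  rewrite map_inj_uniq ?iota_uniq // => i j /invr_inj /eqP.
  by rewrite eqr_nat => /eqP[].
exists (i.+2%:R)^-1; split; [by rewrite invr_gt0 ltr0n| |exact: nt].
by rewrite invf_lt1 ?ltr0n // ltr1n.
Qed.

Section Delaunay.
Variables (F : realFieldType) (V : vectType F).
Implicit Types (X : {fset V}) (x y z : V).

Local Notation covec := 'cV[F]_(dim V).

Definition ev (c : covec) x : F := (v2r x *m c) 0 0.

Lemma evD c x y : ev c (x + y) = ev c x + ev c y.
Proof. by rewrite /ev linearD mulmxDl mxE. Qed.
Lemma evN c x : ev c (- x) = - ev c x.
Proof. by rewrite /ev linearN mulNmx mxE. Qed.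
Lemma evB c x y : ev c (x - y) = ev c x - ev c y.
Proof. by rewrite evD evN. Qed.
Lemma evMn c x n : ev c (x *+ n) = ev c x *+ n.
Proof. by rewrite /ev raddfMn -scaler_nat -scalemxAl mxE mulr_natl. Qed.
Lemma ev_add c e x : ev (c + e) x = ev c x + ev e x.
Proof. by rewrite /ev mulmxDr mxE. Qed.
Lemma ev_scale a c x : ev (a *: c) x = a * ev c x.
Proof. by rewrite /ev -scalemxAr mxE. Qed.

Definition sqn x : F := ev (v2r x)^T x.

Lemma ev_sym x y : ev (v2r x)^T y = ev (v2r y)^T x.
Proof. by rewrite /ev !mxE; apply: eq_bigr => i _; rewrite !mxE mulrC. Qed.

Lemma sqn_gt0 x : x != 0 -> 0 < sqn x.
Proof.
move=> x0; rewrite /sqn /ev mxE.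
under eq_bigr do rewrite mxE -expr2.
have [i xi] : exists i, v2r x 0 i != 0.
  apply: contrapT => H; case/eqP: x0; apply: (can_inj v2rK); rewrite linear0.
  apply/rowP => i; rewrite mxE; apply/eqP; apply: contraT => h; case: H.
  by exists i.
rewrite (bigD1 i) //= ltr_pwDl ?exprn_even_gt0 //.
by apply: sumr_ge0 => j _; rewrite sqr_ge0.
Qed.

(** The height function [sqn] lies above its tangent at x by [sqn (z - x)]. *)
Lemma sqnB x z : sqn (z - x) = sqn z - sqn x - ev (2 *: (v2r x)^T) (z - x).
Proof.
rewrite /sqn linearB /= linearB /= ev_add ev_scale.
have -> : ev (- (v2r x)^T) (z - x) = - ev (v2r x)^T (z - x).
  by rewrite -scaleN1r ev_scale mulN1r.
by rewrite !evB [ev _ x in X in X - _]ev_sym; ring.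
Qed.

(** The cokernel matrix of U vanishes exactly on U, so one of its columns separates
z from U. *)
Lemma separating (U : {vspace V}) z : z \notin U ->
  exists2 c, (forall y, y \in U -> ev c y = 0) & ev c z != 0.
Proof.
have memK y : (y \in U) = (v2r y *m cokermx (vs2mx U) == 0).
  by rewrite memvE /subsetv genmxE submxE.
rewrite memK => zU; have [j zj] : exists j, (v2r z *m cokermx (vs2mx U)) 0 j != 0.
  apply: contrapT => H; case/eqP: zU; apply/rowP => j; rewrite [RHS]mxE.
  by apply/eqP; apply: contraT => h; case: H; exists j.
have evj y : ev (col j (cokermx (vs2mx U))) y = (v2r y *m cokermx (vs2mx U)) 0 j.
  by rewrite /ev !mxE; apply: eq_bigr => i _; rewrite !mxE.
exists (col j (cokermx (vs2mx U))); last by rewrite evj.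
by move=> y; rewrite memK evj => /eqP->; rewrite mxE.
Qed.

(** The affine function through the point over x with slope c lies below h on X;
these slopes form the Voronoi cell of x when h is the squared norm. *)
Definition supports (h : V -> F) X (c : covec) x :=
  forall z, z \in X -> h x + ev c (z - x) <= h z.

Definition tight (h : V -> F) X (c : covec) x : {fset V} :=
  [fset z in X | h z == h x + ev c (z - x)].

Definition tight_dir h X c x : {vspace V} :=
  <<[seq y - x | y <- tight h X c x]>>%VS.

Lemma mem_tight_dir h X c x y :
  y \in X -> h y = h x + ev c (y - x) -> y - x \in tight_dir h X c x.
Proof.
move=> yX e; apply/memv_span/mapP; exists y => //.
by rewrite !inE yX e eqxx.
Qed.

(** Turn the supporting hyperplane around the points that it already touches,
towards z, until it touches another point of the graph of h. *)
Lemma tilt h X c x z : z \in X -> supports h X c x -> z - x \notin tight_dir h X c x ->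
  exists2 c', supports h X c' x &
    (\dim (tight_dir h X c x) < \dim (tight_dir h X c' x))%N.
Proof.
move=> zX sup /separating[c1 c10 c1z].
have {c1 c10 c1z} [c1 c10 c1z] : exists2 c1,
    (forall y, y \in tight_dir h X c x -> ev c1 y = 0) & 0 < ev c1 (z - x).
  move: c1z; rewrite neq_lt => /orP[c1z|]; last by exists c1.
  exists (-1 *: c1); last by rewrite ev_scale mulN1r oppr_gt0.
  by move=> y yT; rewrite ev_scale c10 ?mulr0.
pose P := [fset y in X | 0 < ev c1 (y - x)].
(* The amount of tilt at which the hyperplane reaches the point over y. *)
pose r y := (h y - h x - ev c (y - x)) / ev c1 (y - x).
have [|t] := @fset_min F [fset r y | y in P].
  by apply/fset0Pn; exists (r z); apply/imfsetP; exists z; rewrite //= !inE zX.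
move=> /imfsetP[y0 /= + ->]; rewrite !inE => /andP[y0X c1y0] rmin.
have r0 : 0 <= r y0.
  by rewrite divr_ge0 ?(ltW c1y0) // -addrA -opprD subr_ge0 sup.
exists (c + r y0 *: c1).
  move=> y yX; rewrite ev_add ev_scale.
  have [c1y|c1y] := ltP 0 (ev c1 (y - x)).
    have : r y0 <= r y.
      by apply: rmin; apply/imfsetP; exists y; rewrite //= !inE yX.
    by rewrite {2}/r ler_pdivlMr //; lra.
  have := sup y yX; have : r y0 * ev c1 (y - x) <= 0 by rewrite mulr_ge0_le0.
  lra.
have e0 : h y0 = h x + ev (c + r y0 *: c1) (y0 - x).
  by rewrite ev_add ev_scale /r divfK ?gt_eqF //; ring.
have sub : (tight_dir h X c x <= tight_dir h X (c + r y0 *: c1) x)%VS.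
  apply/span_subvP => _ /mapP[y + ->]; rewrite !inE => /andP[yX /eqP ye].
  apply: mem_tight_dir => //; rewrite ev_add ev_scale c10 ?mulr0 ?addr0 //.
  exact: mem_tight_dir.
rewrite ltn_neqAle dimvS // andbT (dimv_leqif_sup sub).2.
apply/negP => /subvP/(_ _ (mem_tight_dir y0X e0))/c10 c1y.
by move: c1y0; rewrite c1y ltxx.
Qed.

(** Tilting as long as possible ends at a vertex of the polyhedron of supporting
slopes, where the touching points span all directions of X. *)
Lemma tight_spans h X x : (exists c, supports h X c x) ->
  exists2 c, supports h X c x & forall z, z \in X -> z - x \in tight_dir h X c x.
Proof.
move=> [c0 sup0].
have H m c : supports h X c x -> (\dim {:V} <= \dim (tight_dir h X c x) + m)%N ->
    exists2 c, supports h X c x & forall z, z \in X -> z - x \in tight_dir h X c x.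
  elim: m c => [|m IH] c sup.
    rewrite addn0 => full; exists c => // z _.
    have : (tight_dir h X c x == fullv)%VS by rewrite eqEdim subvf.
    by move=> /eqP->; exact: memvf.
  move=> dm; have [[z zX zT]|nz] := EM (exists2 z, z \in X & z - x \notin tight_dir h X c x).
    have [c' sup' lt] := tilt zX sup zT.
    by apply: (IH c') => //; apply: leq_trans dm _; rewrite addnS -addSn leq_add2r.
  exists c => // z zX; apply: contraT => zT; case: nz; by exists z.
by apply: (H (\dim {:V}) c0); rewrite ?leq_addl.
Qed.

Definition direction X : {vspace V} := <<[seq a - b | a <- X, b <- X]>>%VS.

Lemma card_tight h X c x : x \in X ->
  (forall z, z \in X -> z - x \in tight_dir h X c x) ->
  (\dim (direction X) <= #|` tight h X c x `\ x|)%N.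
Proof.
move=> xX sp; pose N := tight h X c x `\ x.
have T1 : (tight_dir h X c x <= <<[seq y - x | y <- N]>>)%VS.
  apply/span_subvP => _ /mapP[y yT ->]; have [->|yx] := eqVneq y x.
    by rewrite subrr mem0v.
  by apply/memv_span/mapP; exists y; rewrite // !inE yx; move: yT; rewrite !inE.
apply: leq_trans (dimvS _) (leq_trans (dimvS T1) _).
  apply/span_subvP => _ /allpairsP[[a b] /= [aX bX ->]].
  by rewrite -(subrK x a) -addrA -[x - b]opprB memvB ?sp.
by apply: leq_trans (dim_span _) _; rewrite size_map.
Qed.

(** Edges of the Delaunay triangulation, or of the regular triangulation given by h:
a supporting affine function touches the graph of h at both ends. *)
Definition adj h X x y := exists2 c, supports h X c x & h y = h x + ev c (y - x).

Lemma adj_sym h X x y : adj h X x y -> adj h X y x.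
Proof.
move=> [c sup e]; exists c; last by rewrite e !evB; ring.
by move=> z zX; have := sup z zX; rewrite e !evB; lra.
Qed.

(** An affine function takes the same weighted sum at two pairs of points with the
same weighted sum, equals h at the ends of an edge and is nowhere above h on X. *)
Lemma adj_height_le h X q s x y x' y' : adj h X x y -> x' \in X -> y' \in X ->
  x *+ q + y *+ s = x' *+ q + y' *+ s ->
  h x *+ q + h y *+ s <= h x' *+ q + h y' *+ s.
Proof.
move=> [c sup hy] x'X y'X e; rewrite hy.
have : h x *+ q + (h x + ev c (y - x)) *+ s =
   (h x + ev c (x' - x)) *+ q + (h x + ev c (y' - x)) *+ s.
  have : ev c (x *+ q + y *+ s) = ev c (x' *+ q + y' *+ s) by rewrite e.
  rewrite !evD !evMn !evN !mulrnDl !mulNrn.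
  move: (ev c x *+ q) (ev c x *+ s) (ev c y *+ s) (ev c x' *+ q) (ev c y' *+ s).
  by move: (h x *+ q) (h x *+ s) => *; lra.
move=> ->; by apply: lerD; rewrite lerMn2r sup ?orbT.
Qed.

(** Difference of the weighted heights of two pairs, when the height [w] of each
point z of X is perturbed by t to the power [(index z X).+1], as a polynomial in t. *)
Definition height_gap X (w : V -> F) (q s : nat) x y x' y' : {poly F} :=
  (w x *+ q + w y *+ s - (w x' *+ q + w y' *+ s))%:P
  + ('X^((index x X).+1) *+ q + 'X^((index y X).+1) *+ s
     - ('X^((index x' X).+1) *+ q + 'X^((index y' X).+1) *+ s)).

(** The perturbations of different points are different monomials, and the
coefficients q and s are distinct, so the monomials cannot cancel. *)
Lemma height_gap_neq0 X w q s x y x' y' : (0 < q)%N -> (0 < s)%N -> q != s ->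
  x \in X -> y \in X -> x' \in X -> y' \in X -> (x, y) != (x', y') ->
  height_gap X w q s x y x' y' != 0.
Proof.
move=> q0 s0 qs xX yX x'X y'X ne; apply/eqP => d0.
have cf z : z \in X -> (q * (x == z) + s * (y == z) = q * (x' == z) + s * (y' == z))%N.
  move=> zX; have := congr1 (fun p : {poly F} => p`_(index z X).+1) d0.
  rewrite /height_gap coef0 coefD coefC add0r coefB !coefD !coefMn !coefXn !eqSS.
  have idx u : u \in X -> (index z X == index u X) = (u == z).
    move=> uX; rewrite eq_sym; apply/eqP/eqP => [e|->//].
    by rewrite -(nth_index z uX) e nth_index.
  rewrite !idx // => /eqP; rewrite subr_eq0 -!mulrnA -!mulrnDr eqr_nat.
  by move=> /eqP; rewrite ![(_ * q)%N]mulnC ![(_ * s)%N]mulnC.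
have h1 := cf x xX; have h2 := cf y yX.
move: h1 h2 ne; rewrite !eqxx xpair_eqE.
rewrite [x' == x]eq_sym [y' == y]eq_sym [y == x]eq_sym.
case: (x =P y) => [->|_]; first by case: (y == x'); case: (y == y'); lia.
case: (x == x') => /=; first by case: (y == y'); case: (y' == x); case: (x' == y); lia.
by case: (y == y'); case: (y' == x); case: (x' == y); lia.
Qed.

(** A large multiple of the squared norm, so that each point of X has a supporting
hyperplane even after a perturbation of size 1, plus a perturbation that avoids
the finitely many roots of the [height_gap] polynomials. *)
Lemma exists_generic_height X q s : (0 < q)%N -> (0 < s)%N -> q != s ->
  exists h : V -> F,
  (forall x, x \in X -> exists c, supports h X c x) /\
  (forall x y x' y', x \in X -> y \in X -> x' \in X -> y' \in X ->
    h x *+ q + h y *+ s = h x' *+ q + h y' *+ s -> (x, y) = (x', y')).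
Proof.
move=> q0 s0 qs.
(* Each term is at most M, so that [M * sqn (z - x)] is at least 1
   for distinct points x and z of X. *)
pose M := \sum_(p <- X `*` X) (sqn (p.2 - p.1))^-1.
have Mge x z : x \in X -> z \in X -> x != z -> 1 <= M * sqn (z - x).
  move=> xX zX xz; have sp : 0 < sqn (z - x) by rewrite sqn_gt0 // subr_eq0 eq_sym.
  rewrite -ler_pdivrMr // div1r /M (big_fsetD1 (x, z)) /=; last by rewrite !inE xX.
  rewrite lerDl; apply: sumr_ge0 => p _; rewrite invr_ge0.
  have [->|/sqn_gt0/ltW//] := eqVneq (p.2 - p.1) 0.
  by rewrite /sqn /ev linear0 mul0mx mxE.
pose w x := M * sqn x.
pose Q := ((X `*` X) `*` (X `*` X)).
pose P := \prod_(u <- Q | u.1 != u.2) height_gap X w q s u.1.1 u.1.2 u.2.1 u.2.2.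
have P0 : P != 0.
  rewrite /P big_seq_cond prodf_seq_neq0; apply/allP => -[[x y] [x' y']] _.
  apply/implyP; rewrite !inE /= => /andP[/andP[/andP[? ?] /andP[? ?]] ?].
  exact: height_gap_neq0.
have [t [t0 t1 nt]] := exists_nonroot P0.
pose h z := w z + t ^+ (index z X).+1.
have tb z : 0 < t ^+ (index z X).+1 < 1.
  by rewrite exprn_gt0 //= exprn_ilt1 // ltW.
exists h; split=> [x xX|x y x' y' xX yX x'X y'X e].
  exists (M *: (2 *: (v2r x)^T)) => z zX.
  have [->|xz] := eqVneq z x; first by rewrite subrr /ev linear0 mul0mx mxE addr0.
  have := Mge x z xX zX; rewrite eq_sym xz => /(_ isT); rewrite sqnB.
  have := tb x; have := tb z; rewrite !ev_scale /h /w.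
  move: (t ^+ _) (t ^+ _) => a b /andP[? ?] /andP[? ?]; rewrite !mulrBr => ?; lra.
apply/eqP; apply: contraNT nt => ne.
rewrite /P rootE horner_prod prodf_seq_eq0; apply/hasP.
exists ((x, y), (x', y')); first by rewrite !inE /= xX yX x'X.
rewrite ne /= /height_gap hornerD hornerC hornerD hornerN !hornerD !hornerMn !hornerXn.
apply/eqP; move: e; rewrite /h !mulrnDl.
move: (w x *+ q) (w y *+ s) (w x' *+ q) (w y' *+ s) => a b c d.
move: (t ^+ (index x X).+1 *+ q) (t ^+ (index y X).+1 *+ s).
move: (t ^+ (index x' X).+1 *+ q) (t ^+ (index y' X).+1 *+ s) => *; lra.
Qed.

(** Two edges with a common point [q x + s y] have the same weighted height there,
by [adj_height_le] used both ways; this is excluded by genericity. The k neighbours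
chosen for x exist since the points touched at a vertex span all directions. *)
Theorem delaunay_graph X q s k : (0 < q)%N -> (0 < s)%N -> q != s ->
  (k <= \dim (direction X))%N ->
  exists (A : V -> V -> Prop) (N : V -> {fset V}),
  [/\ forall x, x \in X -> [/\ N x `<=` X, x \notin N x & #|` N x| = k],
      forall x y, x \in X -> y \in N x -> A x y /\ A y x,
      forall x, x \in X -> A x x &
      forall x y x' y', x \in X -> y \in X -> x' \in X -> y' \in X ->
        A x y -> A x' y' -> x *+ q + y *+ s = x' *+ q + y' *+ s -> (x, y) = (x', y')].
Proof.
move=> q0 s0 qs kX; have [h [hc hg]] := exists_generic_height X q0 s0 qs.
have nb x : exists Nx : {fset V}, x \in X -> [/\ Nx `<=` X, x \notin Nx, #|` Nx| = k &
    forall y, y \in Nx -> adj h X x y].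
  have [xX|] := boolP (x \in X); last by exists fset0.
  have [c sup sp] := tight_spans (hc x xX).
  have := leq_trans kX (card_tight xX sp).
  move=> /exists_subset_card[B BN cB]; exists B => _; split=> //.
  - by apply/fsubsetP => y /(fsubsetP BN); rewrite !inE => /andP[_ /andP[]].
  - by apply/negP => /(fsubsetP BN); rewrite !inE eqxx.
  by move=> y /(fsubsetP BN); rewrite !inE => /and3P[_ _ /eqP e]; exists c.
have [N HN] := boolp.choice nb.
exists (adj h X), N; split.
- by move=> x /HN[? ? ? _].
- by move=> x y /HN[_ _ _ H] /H a; split=> //; exact: adj_sym.
- by move=> x /hc[c sup]; exists c; rewrite ?subrr ?/ev ?linear0 ?mul0mx ?mxE ?addr0.
move=> x y x' y' xX yX x'X y'X a a' e; apply: hg => //.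
by apply: le_anti; rewrite (adj_height_le a x'X y'X e) (adj_height_le a' xX yX (esym e)).
Qed.
End Delaunay.

(** * Adding up over a fibration by lines *)

Lemma common_denominator (C : {fset rat}) :
  exists2 N : int, N != 0 & forall c, c \in C -> exists z : int, c * N%:~R = z%:~R.
Proof.
exists (\prod_(c <- C) denq c).
  by rewrite prodf_seq_neq0; apply/allP => c _; rewrite /= denq_neq0.
move=> c cC; rewrite (big_fsetD1 c) //=.
exists (numq c * \prod_(y <- C `\ c) denq y).
by rewrite !rmorphM /= mulrA -numqE.
Qed.

Lemma one_dim_rat q s : (0 < q)%N -> (0 < s)%N -> coprime q s ->
  exists B, forall C : {fset rat}, ((q + s) * #|` C| <= #|` dsum q s C C| + B)%N.
Proof.
move=> q0 s0 co; have [B HB] := one_dim q0 s0 co; exists B => C.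
have [N N0 HN] := common_denominator C.
have NQ : N%:~R != 0 :> rat by rewrite intr_eq0.
pose f (z : int) : rat := z%:~R / N%:~R.
have fI : injective f.
  by move=> x y /(mulIf (_ : N%:~R^-1 != 0)) h; apply/eqP; rewrite -(eqr_int rat) h // invr_eq0.
pose Z := [fset numq (c * N%:~R) | c in C].
have -> : C = f @` Z.
  have fg c : c \in C -> f (numq (c * N%:~R)) = c.
    by move=> /HN[z e]; rewrite /f e numq_int -e mulfK.
  apply/fsetP => c; apply/idP/imfsetP.
    move=> cC; exists (numq (c * N%:~R)); last by rewrite fg.
    by apply/imfsetP; exists c.
  by move=> [_ /= /imfsetP[c' /= c'C ->] ->]; rewrite fg.
rewrite dsum_imfset; last first.
  by move=> a b; rewrite /f rmorphD !rmorphMn /= mulrDl !mulrnAl.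
by rewrite !(card_imfset _ _ fI) /=; exact: HB.
Qed.

Section Fibration.
Variables (V : vectType rat) (w : V) (phi : V -> rat).
Hypothesis phiB : forall a b, phi (a - b) = phi a - phi b.
Hypothesis phi_dsum : forall q s a b, phi (a *+ q + b *+ s) = phi a *+ q + phi b *+ s.

(** Projection along w onto the kernel of phi, for phi with value 1 at w. *)
Definition proj (a : V) := a - phi a *: w.

Lemma proj_dsum q s a b : proj (a *+ q + b *+ s) = proj a *+ q + proj b *+ s.
Proof.
rewrite /proj phi_dsum !mulrnBl scalerDl !scalerMnl opprD.
by rewrite addrACA.
Qed.

Lemma proj_inj a b : proj a = proj b -> phi a = phi b -> a = b.
Proof. by rewrite /proj => e1 e2; move: e1; rewrite e2 => /addIr. Qed.

Variable A : {fset V}.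
Let X := proj @` A.

Definition fibre x := [fset a in A | proj a == x].

(** A difference of points of A is the difference of their projections up to a
multiple of w. *)
Lemma dim_proj : (\dim (direction A) <= (\dim (direction X)).+1)%N.
Proof.
have : (direction A <= direction X + <[w]>)%VS.
  apply/span_subvP => _ /allpairsP[[a b] /= [aA bA ->]].
  have -> : a - b = (proj a - proj b) + phi (a - b) *: w.
    rewrite phiB scalerBl /proj; move: (phi a *: w) (phi b *: w) => u v.
    by rewrite opprB [RHS]addrC addrA [u - v + _]addrC [a - u + _]addrA subrK addrA subrK.
  apply: memv_add; last by rewrite memvZ // memv_line.
  apply/memv_span/allpairsP; exists (proj a, proj b); split=> //=; apply/imfsetP;
    [by exists a|by exists b].
move/dimvS/leq_trans; apply; apply: leq_trans (dimv_add_leqif _ _) _.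
by rewrite -addn1 leq_add2l dim_vline leq_b1.
Qed.

Lemma card_fibre_dsum q s x y :
  (#|` dsum q s (phi @` fibre x) (phi @` fibre y)| <= #|` dsum q s (fibre x) (fibre y)|)%N.
Proof.
rewrite dsum_imfset; last exact: phi_dsum.
exact: leq_imfset_card.
Qed.

Lemma card_fibre x : #|` phi @` fibre x| = #|` fibre x|.
Proof.
rewrite card_in_imfset //= => a b; rewrite !inE => /andP[_ /eqP ax] /andP[_ /eqP bx].
by apply: proj_inj; rewrite ax bx.
Qed.

Lemma fibre_neq0 x : x \in X -> fibre x != fset0.
Proof.
by move=> /imfsetP[a /= aA ->]; apply/fset0Pn; exists a; rewrite !inE aA eqxx.
Qed.

(** The graph b below consists of the edges that were chosen from either end. Each
vertex has at least k neighbours in b, each edge is used in both orders, and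
there are at most [2 k |X|] ordered edges. *)
Lemma fibration_bound q s k B : (0 < q)%N -> (0 < s)%N -> q != s ->
  (forall C : {fset rat}, (q + s) * #|` C| <= #|` dsum q s C C| + B)%N ->
  (k < \dim (direction A))%N ->
  ((q + s + 2 * k) * #|` A| <= #|` dsum q s A A| + (B + 2 * k) * #|` X|)%N.
Proof.
move=> q0 s0 qs HB dA.
have kX : (k <= \dim (direction X))%N by rewrite -ltnS (leq_trans dA) ?dim_proj.
have [adj [N [NX adjN adjx uniq]]] := delaunay_graph q0 s0 qs kX.
pose b x y := (y \in N x) || (x \in N y).
have bxx x : x \in X -> b x x = false by move=> /NX[_ /negPf h _]; rewrite /b h.
have badj x y : x \in X -> y \in X -> (x == y) || b x y -> adj x y.
  move=> xX yX; case: eqP => [->|_] /=; first by move=> _; exact: adjx.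
  by case/orP => h; [case: (adjN _ _ xX h)|case: (adjN _ _ yX h)].
pose a x := #|` fibre x|.
pose G x y := #|` dsum q s (fibre x) (fibre y)|.
have sumG : (\sum_(x <- X) \sum_(y <- X) ((x == y) || b x y) * G x y <= #|` dsum q s A A|)%N.
  pose J := [fset p in X `*` X | (p.1 == p.2) || b p.1 p.2].
  apply: leq_trans (card_disjoint_family (I := J)
    (G := fun p => dsum q s (fibre p.1) (fibre p.2)) _ _).
  - rewrite -(sum_fsetM X X (fun p => ((p.1 == p.2) || b p.1 p.2) * G p.1 p.2)%N).
    rewrite [X in (_ <= X)%N]big_fset /= [X in (_ <= X)%N]big_mkcond /=.
    by apply: leq_sum => p _; case: ifP => _; rewrite ?mul1n.
  - by move=> p _; apply: dsumS; apply/fsubsetP => u; rewrite !inE => /andP[].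
  move=> [x y] [x' y'] z; rewrite !inE /= => /andP[/andP[xX yX] h] /andP[/andP[x'X y'X] h'].
  move=> /dsumP[u + [v + ->]] /dsumP[u' + [v' + e]].
  rewrite !inE => /andP[_ /eqP ux] /andP[_ /eqP vy] /andP[_ /eqP ux'] /andP[_ /eqP vy'].
  apply: uniq => //; try exact: badj.
  by have := congr1 proj e; rewrite !proj_dsum ux vy ux' vy'.
(* The one-dimensional bound on the diagonal and the two-set bound on edges,
   with the errors charged to the diagonal and to the chosen edges. *)
have key x y : x \in X -> y \in X ->
   ((x == y) * ((q + s) * a x) + b x y * (a x + a y)
     <= ((x == y) || b x y) * G x y + (x == y) * B + ((y \in N x) + (x \in N y)))%N.
  move=> xX yX; case: eqP => [<-|_] /=.
    rewrite bxx // mul0n addn0 !mul1n (leq_trans _ (leq_addr _ _)) //.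
    rewrite /a -card_fibre (leq_trans (HB _)) // leq_add2r.
    exact: card_fibre_dsum.
  have [bxy|nb] := boolP (b x y); last by rewrite !mul0n.
  rewrite !mul0n !mul1n add0n addn0.
  have h1 : (1 <= (y \in N x) + (x \in N y))%N.
    by move: bxy; rewrite /b; case: (y \in N x); case: (x \in N y).
  have h2 : (a x + a y <= G x y + 1)%N.
    rewrite /a -!card_fibre (leq_trans (@card_dsum_ge rat q s _ _ q0 s0 _ _)) //.
    - by rewrite -cardfs_gt0 card_fibre cardfs_gt0 fibre_neq0.
    - by rewrite -cardfs_gt0 card_fibre cardfs_gt0 fibre_neq0.
    by rewrite leq_add2r card_fibre_dsum.
  by rewrite (leq_trans h2) // leq_add2l.
have diagsum (f : V -> nat) : (\sum_(x <- X) \sum_(y <- X) (x == y) * f x = \sum_(x <- X) f x)%N.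
  rewrite big_seq [RHS]big_seq; apply: eq_bigr => x xX.
  rewrite (big_fsetD1 x) //= eqxx mul1n big_seq big1 ?addn0 // => y.
  by rewrite !inE eq_sym => /andP[/negPf->].
have sa : (\sum_(x <- X) a x = #|` A|)%N.
  by apply: sum_card_fibres => u uA; apply/imfsetP; exists u.
have sN x : x \in X -> (\sum_(y <- X) (y \in N x : nat) = k)%N.
  by move=> /NX[NxX _ <-]; exact: sum_indicator.
have degl : (k * #|` A| <= \sum_(x <- X) \sum_(y <- X) b x y * a x)%N.
  rewrite -sa big_distrr /= big_seq [X in (_ <= X)%N]big_seq; apply: leq_sum => x xX.
  rewrite -big_distrl /= leq_mul2r -(sN x xX); apply/orP; right.
  by apply: leq_sum => y _; rewrite /b; case: (y \in N x).
have degr : (\sum_(x <- X) \sum_(y <- X) b x y * a y = \sum_(x <- X) \sum_(y <- X) b x y * a x)%N.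
  by rewrite exchange_big /=; apply: eq_bigr => x _; apply: eq_bigr => y _; rewrite /b orbC.
have SN : (\sum_(x <- X) \sum_(y <- X) (y \in N x : nat) = k * #|` X|)%N.
  by rewrite mulnC -sum_const_fset big_seq [RHS]big_seq; apply: eq_bigr => x /sN.
have : (\sum_(x <- X) \sum_(y <- X) ((x == y) * ((q + s) * a x) + b x y * (a x + a y))
  <= \sum_(x <- X) \sum_(y <- X)
    (((x == y) || b x y) * G x y + (x == y) * B + ((y \in N x) + (x \in N y))))%N.
  rewrite big_seq [X in (_ <= X)%N]big_seq; apply: leq_sum => x xX.
  by rewrite big_seq [X in (_ <= X)%N]big_seq; apply: leq_sum => y yX; exact: key.
have -> : (\sum_(x <- X) \sum_(y <- X) ((x == y) * ((q + s) * a x) + b x y * (a x + a y))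
   = (q + s) * #|` A| + (\sum_(x <- X) \sum_(y <- X) b x y * a x + \sum_(x <- X) \sum_(y <- X) b x y * a y))%N.
  rewrite -sa big_distrr /= -(diagsum (fun x => (q + s) * a x)%N) -!big_split /=.
  apply: eq_bigr => x _; rewrite -!big_split /=; apply: eq_bigr => y _; by rewrite mulnDr.
have -> : (\sum_(x <- X) \sum_(y <- X)
    (((x == y) || b x y) * G x y + (x == y) * B + ((y \in N x) + (x \in N y))) =
  \sum_(x <- X) \sum_(y <- X) ((x == y) || b x y) * G x y + B * #|` X| + 2 * (k * #|` X|))%N.
  under eq_bigr => x _ do rewrite !big_split /=.
  rewrite !big_split /= (diagsum (fun=> B)) sum_const_fset SN.
  by rewrite [X in (_ + (_ + X))%N]exchange_big /= SN addnn -mul2n [(B * _)%N]mulnC.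
rewrite degr => h.
have := leq_add degl degl; rewrite -(leq_add2l ((q + s) * #|` A|)) => h1.
have := leq_trans h1 h; rewrite -!addnA => h2.
have := leq_trans h2 (leq_add sumG (leqnn _)).
move: (#|` A|) (#|` dsum _ _ A A|) (#|` X|) => x y z; lia.
Qed.
End Fibration.

(** * The bound over the rationals, and rational coordinates *)

Lemma lmod_torsion_free (V : lmodType rat) : torsion_free V.
Proof.
move=> x n n0 /eqP; rewrite -scaler_nat scaler_eq0 pnatr_eq0 (gtn_eqF n0) /=.
by move=> /eqP.
Qed.

Lemma exists_coordinate (V : vectType rat) (w : V) : w != 0 -> exists phi : V -> rat,
  [/\ forall a b, phi (a - b) = phi a - phi b,
      forall q s a b, phi (a *+ q + b *+ s) = phi a *+ q + phi b *+ s & phi w = 1].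
Proof.
move=> w0; have [|c _ cw] := @separating _ V 0%VS w; first by rewrite memv0.
exists (fun a => ev c a / ev c w); split=> [a b|q s a b|].
- by rewrite evB mulrBl.
- by rewrite evD !evMn mulrDl !mulrnAl.
by rewrite divff.
Qed.

(** The error term is left in terms of m with [|A| <= M ^ (m + 1)]; a
set with a sum of dilates larger than the main term needs no error term at all. *)
Theorem rational_bound q s k : (0 < q)%N -> (0 < s)%N -> coprime q s -> q != s ->
  exists M K, forall (V : vectType rat) (A : {fset V}), (k < \dim (direction A))%N ->
  exists2 m, (#|` A| <= M ^ m.+1)%N &
    ((q + s + 2 * k) * #|` A| * 2 ^ m <= #|` dsum q s A A| * 2 ^ m + K * #|` A|)%N.
Proof.
move=> q0 s0 co qs; have [B HB] := one_dim_rat q0 s0 co.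
pose C := (q + s + 2 * k)%N; have [M [K H]] := few_lines C q0 s0.
exists M.+2, ((B + 2 * k) * K)%N => V A dA.
have A2 : (1 < #|` A|)%N.
  rewrite ltnNge; apply: contraL dA => A1; rewrite -leqNgt.
  suff -> : direction A = 0%VS by rewrite dimv0.
  apply/eqP; rewrite -subv0; apply/span_subvP => _ /allpairsP[[a b] /= [aA bA ->]].
  have -> : a = b; last by rewrite subrr mem0v.
  apply/eqP; apply: contraLR A1 => ab; rewrite -ltnNge.
  rewrite (cardfsD1 a) aA (cardfsD1 b) !inE eq_sym ab bA; lia.
have [le|lt] := leqP #|` dsum q s A A| (C * #|` A|)%N; last first.
  exists #|` A|; last by rewrite (leq_trans _ (leq_addr _ _)) // leq_mul2r (ltnW lt) orbT.
  by apply: ltnW; apply: leq_trans (ltn_expl _ _); rewrite ?leqnSn.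
have [w w0 [m Mm lines]] := H V (@lmod_torsion_free V) A A2 le.
exists m; first by rewrite (leq_trans Mm) // leq_exp2r // leqW.
have [phi [phiB phiD phiw]] := exists_coordinate w0.
have fb := @fibration_bound V w phi phiB phiD A q s k B q0 s0 qs HB dA.
have [S [SA Sinj cS]] := exists_section (proj w phi) A.
have projw a i : proj w phi (a + w *+ i) = proj w phi a.
  rewrite -[a in LHS]mulr1n (proj_dsum _ phiD) mulr1n.
  by rewrite [proj w phi w]/proj phiw scale1r subrr mul0rn addr0.
have h := lines S SA (fun a a' i j aS a'S e => Sinj a a' aS a'S
  (etrans (esym (projw a i)) (etrans (congr1 _ e) (projw a' j)))).
rewrite cS in h; have h1 := leq_mul fb (leqnn (2 ^ m)).
by rewrite (leq_trans h1) // mulnDl leq_add2l -!mulnA leq_mul2l h orbT.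
Qed.

Lemma dsum_sumset (R : realType) d (q s : int) (A : {fset 'rV[R]_d}) : 0 < q * s ->
  #|` sumset (dilate q%:~R A) (dilate s%:~R A)| = #|` dsum `|q|%N `|s|%N A A|.
Proof.
have sc (n : nat) (x : 'rV[R]_d) : n%:~R *: x = x *+ n.
  by rewrite -pmulrn scaler_nat.
have pos (q' s' : nat) : sumset (dilate q'%:~R A) (dilate s'%:~R A) = dsum q' s' A A.
  apply/fsetP => z; apply/sumsetP/dsumP.
    move=> [_ /imfsetP[a /= aA ->] [_ /imfsetP[b /= bA ->] ->]].
    by exists a => //; exists b => //; rewrite !sc.
  move=> [a aA [b bA ->]]; exists (q'%:~R *: a); first by apply/imfsetP; exists a.
  exists (s'%:~R *: b); first by apply/imfsetP; exists b.
  by rewrite !sc.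
have neg (q' s' : nat) : sumset (dilate (- q'%:Z)%:~R A) (dilate (- s'%:Z)%:~R A) =
    -%R @` (sumset (dilate q'%:~R A) (dilate s'%:~R A)).
  apply/fsetP => z; apply/sumsetP/imfsetP.
    move=> [_ /imfsetP[a /= aA ->] [_ /imfsetP[b /= bA ->] ->]].
    exists (q'%:~R *: a + s'%:~R *: b); last by rewrite !mulrNz !scaleNr opprD.
    by apply: mem_sumset; apply/imfsetP; [exists a|exists b].
  move=> [_ /= /sumsetP[_ /imfsetP[a /= aA ->] [_ /imfsetP[b /= bA ->] ->]] ->].
  exists ((- q'%:Z)%:~R *: a); first by apply/imfsetP; exists a.
  exists ((- s'%:Z)%:~R *: b); first by apply/imfsetP; exists b.
  by rewrite !mulrNz !scaleNr opprD.
case: q s => [q'|q'] [s'|s'] qs.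
- by rewrite pos.
- by move: qs; rewrite NegzE mulrN oppr_gt0 ltNge mulr_ge0.
- by move: qs; rewrite NegzE mulNr oppr_gt0 ltNge mulr_ge0.
rewrite !NegzE neg card_imfset; last exact: oppr_inj.
by rewrite pos !abszN.
Qed.

(** Among all rational combinations of rows that produce A, one with the least
number of rows has rationally independent rows: a dependency would let one row be
eliminated. *)
Lemma exists_rational_coordinates (R : realType) d (A : {fset 'rV[R]_d}) :
  exists n (B : {fset 'rV[rat]_n}) (M : 'M[R]_(n, d)),
    (forall x : 'rV[rat]_n, map_mx ratr x *m M = 0 -> x = 0) /\
    A = (fun x => map_mx ratr x *m M) @` B.
Proof.
pose good n := exists (M : 'M[R]_(n, d)), forall a, a \in A ->
   exists x : 'rV[rat]_n, a = map_mx ratr x *m M.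
have ex : exists n, `[< good n >].
  exists #|` A|; apply/asboolP.
  exists (\matrix_(i < #|` A|) nth 0 A i) => a aA.
  have ia : (index a A < #|` A|)%N by rewrite index_mem.
  exists (delta_mx 0 (Ordinal ia)).
  by rewrite map_delta_mx -rowE rowK /= nth_index.
have inj n (M : 'M[R]_(n, d)) :
    (forall a, a \in A -> exists x : 'rV[rat]_n, a = map_mx ratr x *m M) ->
    (forall m, `[< good m >] -> (n <= m)%N) ->
    forall x : 'rV[rat]_n, map_mx ratr x *m M = 0 -> x = 0.
  case: n M => [|n] M HM nmin x x0; first by apply/rowP => -[].
  apply/eqP; apply: contraT => xn0; exfalso.
  have [i xi] : exists i, x 0 i != 0.
    apply: contrapT => H; case/eqP: xn0; apply/rowP => i; rewrite mxE.
    by apply/eqP; apply: contraT => h; case: H; exists i.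
  have : `[< good n >].
    apply/asboolP; exists (row' i M) => a /HM[y ->].
    pose y' := y - (y 0 i / x 0 i) *: x; exists (col' i y').
    have -> : map_mx ratr y *m M = map_mx ratr y' *m M.
      by rewrite map_mxB map_mxZ mulmxBl -scalemxAl x0 scaler0 subr0.
    have y'0 : y' 0 i = 0 by rewrite !mxE divfK ?subrr.
    apply/rowP => j; rewrite !mxE (bigD1_ord i) //= [map_mx _ _ _ i]mxE y'0.
    by rewrite rmorph0 mul0r add0r; apply: eq_bigr => l _; rewrite !mxE.
  by move=> /nmin; rewrite ltnn.
have [n /asboolP[M HM] nmin] := ex_minnP ex.
have H a : exists x : 'rV[rat]_n, a \in A -> a = map_mx ratr x *m M.
  by have [/HM[x ->]|_] := boolP (a \in A); [exists x|exists 0].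
have [f Hf] := choice H.
exists n, (f @` A), M; split; first exact: inj.
apply/fsetP => a; apply/idP/imfsetP.
  by move=> aA; exists (f a); [apply/imfsetP; exists a|exact: Hf].
by move=> [_ /= /imfsetP[a' /= a'A ->] ->]; rewrite -Hf.
Qed.

(** * The theorem over the reals *)

(** Vectors that span the differences rationally also span them over the reals. *)
Lemma affine_dim_le (R : realType) d n (M : 'M[R]_(n, d)) (B : {fset 'rV[rat]_n}) :
  (affine_dim ((fun x => map_mx ratr x *m M) @` B) <= \dim (direction B))%N.
Proof.
pose f (x : 'rV[rat]_n) := map_mx ratr x *m M.
pose b := vbasis (direction B).
apply: leq_trans (_ : \dim <<[seq f x | x <- b]>>%VS <= _)%N; last first.
  by apply: leq_trans (dim_span _) _; rewrite size_map size_tuple.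
apply: dimvS; apply/span_subvP => _ /allpairsP[[u v] /= [+ + ->]].
move=> /imfsetP[x /= xB ->] /imfsetP[y /= yB ->].
rewrite -mulmxBl -map_mxB.
have /coord_vbasis-> : x - y \in direction B.
  by apply/memv_span/allpairsP; exists (x, y).
rewrite raddf_sum mulmx_suml /=; apply: memv_suml => i _.
rewrite [X in X *m _]map_mxZ -scalemxAl; apply/memvZ/memv_span/mapP.
by exists (vbasis (direction B))`_i => //; apply: mem_nth; rewrite size_tuple.
Qed.

(** With exponent [1 / (M + 1)], [N ^ delta <= 2 ^ (m + 1)] because M is less than
[2 ^ (M + 1)]. *)
Lemma power_saving (R : realType) (M : nat) : exists2 delta : R, 0 < delta &
  forall N m : nat, (0 < N)%N -> (N <= M ^ m.+1)%N ->
    N%:R <= 2 * 2 ^+ m * N%:R `^ (1 - delta) :> R.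
Proof.
have M0 : (M.+1%:R : R) != 0 by rewrite pnatr_eq0.
exists (M.+1%:R^-1); first by rewrite invr_gt0 ltr0n.
move=> N m N0 NM; have N0R : N%:R != 0 :> R by rewrite pnatr_eq0 -lt0n.
have split : N%:R = N%:R `^ (M.+1%:R^-1) * N%:R `^ (1 - M.+1%:R^-1) :> R.
  rewrite -powRD; last by rewrite N0R implybT.
  by rewrite addrC subrK powRr1 ?ler0n.
rewrite [X in X <= _]split ler_wpM2r ?powR_ge0 // -exprS {split}.
have NM' : (N <= 2 ^ (m.+1 * M.+1))%N.
  rewrite (leq_trans NM) // mulnC expnM leq_exp2r //.
  by rewrite (leq_trans (ltnW (ltn_expl M (isT : (1 < 2)%N)))) // leq_pexp2l.
have : (N%:R : R) `^ (M.+1%:R^-1) <= (2 ^ (m.+1 * M.+1))%:R `^ (M.+1%:R^-1).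
  by rewrite ge0_ler_powR ?nnegrE ?invr_ge0 ?ler0n ?ler_nat.
move/le_trans; apply.
rewrite natrX exprM -powR_mulrn ?exprn_ge0 // -powRrM divff // powRr1 //.
Qed.

Theorem theorem1p1 (R : realType) (d : nat) (q s : int)
    (hd : (1 <= d)%N) (hqs : coprimez q s) (hqs1 : 1 < q * s) :
  exists delta K : R, [/\ 0 < delta, 0 < K &
    forall A : {fset 'rV[R]_d}, affine_dim A = d ->
      (`|q|%:~R + `|s|%:~R + 2 * d%:R - 2) * #|` A|%:R
        - K * #|` A|%:R `^ (1 - delta)
      <= #|` sumset (dilate q%:~R A) (dilate s%:~R A)|%:R].
Proof.
pose q' := `|q|%N; pose s' := `|s|%N.
have co : coprime q' s' by [].
have qs1 : (1 < q' * s')%N by rewrite -abszM; lia.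
have q0 : (0 < q')%N by case: (q') qs1.
have s0 : (0 < s')%N by case: (s') qs1 => //; rewrite muln0.
have qs : q' != s'.
  apply: contraTneq co => e; move: qs1; rewrite e /coprime gcdnn => h.
  by apply: contraTneq h => ->.
have [M [K H]] := rational_bound d.-1 q0 s0 co qs.
have [delta delta0 Hd] := power_saving R M.
exists delta, (2 * K%:R + 1); split=> //.
move=> A dA; rewrite dsum_sumset; last exact: lt_trans hqs1.
have [n [B [Mx [MI AE]]]] := exists_rational_coordinates A.
have dB : (d.-1 < \dim (direction B))%N.
  by rewrite prednK // -{1}dA AE affine_dim_le.
have [m Mm hb] := H _ B dB.
pose f (x : 'rV[rat]_n) := map_mx (@ratr R) x *m Mx.
have fB x y : f (x - y) = f x - f y by rewrite /f map_mxB mulmxBl.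
have fD x y : f (x + y) = f x + f y by rewrite /f map_mxD mulmxDl.
have fMn x k : f (x *+ k) = f x *+ k.
  elim: k => [|k IH]; first by rewrite !mulr0n /f map_mx0 mul0mx.
  by rewrite !mulrS fD IH.
have fI : injective f.
  move=> x y e; apply/eqP; rewrite -subr_eq0; apply/eqP/MI.
  by have := fB x y; rewrite e subrr.
have cA : #|` A| = #|` B| by rewrite AE card_imfset.
have cD : #|` dsum q' s' A A| = #|` dsum q' s' B B|.
  rewrite AE dsum_imfset ?card_imfset // => a b.
  by rewrite -[LHS]/(f _) fD !fMn.
rewrite cA cD.
have B0 : (0 < #|` B|)%N.
  rewrite cardfs_gt0; apply: contraTneq dB => ->.
  by rewrite /direction -leqNgt span_nil dimv0.
have hN := Hd _ _ B0 Mm.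
move: hb; rewrite -(ler_nat R) !(natrM, natrD, natrX).
rewrite -!abszE -!pmulrn.
have -> : (d.-1%:R : R) = d%:R - 1 by rewrite -subn1 natrB.
move: hN; set N := (#|` B|%:R : R); set F := (#|` _|%:R : R).
have p2 : 0 < 2 ^+ m :> R by rewrite exprn_gt0.
set P := N `^ _; set T := 2 ^+ m; have P0 : 0 <= P by rewrite powR_ge0.
move=> hN hb; rewrite -(ler_pM2r p2) -/T.
have h1 : K%:R * N <= K%:R * (2 * T * P) by rewrite ler_wpM2l.
have h2 : 0 <= T * P by rewrite mulr_ge0 // ltW.
rewrite -[absz q]/(q') -[absz s]/(s').
nra.
Qed.
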